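(* Let $G$ be a locally free group with $|G|>\aleph_0$. Then for each finitely generated subgroup $A$ of $G$, there exists a subgroup $H$ of $G$ with $|H|=|G|$ such that the subgroup $AH$ of $G$ generated by $A$ and $H$ is isomorphic to the free product $A*H$. In particular, $G$ has a free subgroup of the same cardinality as that of $G$.
   Context: A group is locally free if all of its finitely generated subgroups are free. $|X|$ denotes the cardinality of $X$. *)

(* Defs.v *)
From Stdlib Require Import List.
Import ListNotations.

Record Group : Type := {
  carrier :> Type;
  gmul : carrier -> carrier -> carrier;
  ginv : carrier -> carrier;
  gone : carrier;
  gmul_assoc : forall x y z, gmul x (gmul y z) = gmul (gmul x y) z;
  gmul_1l : forall x, gmul gone x = x;
  gmul_1r : forall x, gmul x gone = x;
  gmul_Vl : forall x, gmul (ginv x) x = gone;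
  gmul_Vr : forall x, gmul x (ginv x) = gone
}.

Arguments gmul {g}.
Arguments ginv {g}.
Arguments gone {g}.

Section GroupDefs.
Variable G : Group.

Definition gset := G -> Prop.

Definition is_subgroup (H : gset) : Prop :=
  H gone /\ (forall x y, H x -> H y -> H (gmul x y)) /\ (forall x, H x -> H (ginv x)).

Definition letter_val (l : G * bool) : G :=
  if snd l then fst l else ginv (fst l).

Fixpoint word_eval (w : list (G * bool)) : G :=
  match w with
  | [] => @gone G
  | l :: w' => gmul (letter_val l) (word_eval w')
  end.

Definition word_over (S : gset) (w : list (G * bool)) : Prop :=
  Forall (fun l => S (fst l)) w.

Definition generated (S : gset) : gset :=
  fun g => exists w, word_over S w /\ word_eval w = g.

Fixpoint reduced (w : list (G * bool)) : Prop :=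
  match w with
  | l1 :: ((l2 :: _) as w') =>
      ~ (fst l1 = fst l2 /\ snd l1 <> snd l2) /\ reduced w'
  | _ => True
  end.

Definition finitely_generated (A : gset) : Prop :=
  is_subgroup A /\ exists s : list G, forall g, A g <-> generated (fun x => In x s) g.

Definition free_subgroup (H : gset) : Prop :=
  is_subgroup H /\
  exists X : gset,
    (forall x, X x -> H x) /\
    (forall g, H g <-> generated X g) /\
    (forall w, word_over X w -> reduced w -> w <> [] -> word_eval w <> gone).

Definition locally_free : Prop :=
  forall A, finitely_generated A -> free_subgroup A.

Definition uncountable_group : Prop :=
  ~ exists f : G -> nat, forall x y, f x = f y -> x = y.

Definition same_card_as_G (H : gset) : Prop :=
  exists f : {x : G | H x} -> G,
    (forall u v, f u = f v -> u = v) /\ (forall g, exists u, f u = g).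

(* Free product A * H, modelled by its normal forms: alternating sequences
   of nontrivial elements, tagged true (from A) or false (from H). *)
Fixpoint alternating (w : list (bool * G)) : Prop :=
  match w with
  | p1 :: ((p2 :: _) as w') => fst p1 <> fst p2 /\ alternating w'
  | _ => True
  end.

Definition normal_form (A H : gset) (w : list (bool * G)) : Prop :=
  Forall (fun p : bool * carrier G => (if fst p then A (snd p) else H (snd p)) /\ snd p <> @gone G) w
  /\ alternating w.

Fixpoint nf_eval (w : list (bool * G)) : G :=
  match w with
  | [] => @gone G
  | p :: w' => gmul (snd p) (nf_eval w')
  end.

Definition join_subgroup (A H : gset) : gset :=
  generated (fun x => A x \/ H x).

(* The canonical homomorphism A * H -> AH (evaluation of normal forms) is an
   isomorphism onto the subgroup AH generated by A and H. *)
Definition is_free_product (A H : gset) : Prop :=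
  (forall w1 w2, normal_form A H w1 -> normal_form A H w2 ->
                 nf_eval w1 = nf_eval w2 -> w1 = w2) /\
  (forall g, join_subgroup A H g <-> exists w, normal_form A H w /\ nf_eval w = g).

End GroupDefs.

Arguments is_subgroup {G}.
Arguments generated {G}.
Arguments finitely_generated {G}.
Arguments free_subgroup {G}.
Arguments same_card_as_G {G}.
Arguments is_free_product {G}.
Arguments join_subgroup {G}.

(* Main.v *)
(** Linearity drives the proof. Every free group of finite rank embeds in
SL2(Z[t]) by a ping-pong argument, hence the locally free group G embeds in
SL2(K) for an ultrapower K of a field, and by Hilbert's basis theorem every
system of one-variable equations over G is equivalent to a finite subsystem.

Let P be a subset of G such that every finite system over P that is solvable in
G is solvable in P, and let g lie outside P. Then some g' in P satisfies all the
equations over P that g satisfies, so with h = g'^-1 g each relation between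
elements of P and h survives the substitution h := 1. If S is a finite free
subset of P with n elements, the group generated by S and h therefore retracts
onto the free group on S with h in the kernel; as free groups are Hopfian and
h <> 1, its rank is n + 1, and S together with h is free.

By Zorn's lemma take a maximal free set S containing a basis Y of A. By
maximality the equational closure of S is all of G. So every element of G is
computed by a finite program over X = S \ Y and countably many instructions, and
such programs can be coded by words in X: the free group H on X has the
cardinality of G, and Y + X being free says that A and H generate A * H. *)

From HB Require Import structures.
From mathcomp Require Import all_boot all_algebra.
From mathcomp Require Import ring zify.
From mathcomp Require Import boolp classical_sets functions cardinality filter.
Require Import Defs.

Set Implicit Arguments.
Unset Strict Implicit.
Unset Printing Implicit Defensive.

Import GRing.Theory.

(** * Words and ping-pong in SL2 *)

Section Words.
Variables (T : Group) (X : Type) (f : X -> T).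
Implicit Types (w : seq (X * bool)).

Lemma ginvK (x : T) : ginv (ginv x) = x.
Proof.
by rewrite -[LHS]gmul_1r -(gmul_Vl T x) gmul_assoc gmul_Vl gmul_1l.
Qed.

Lemma gmul_cancel_l (x y z : T) : gmul x y = gmul x z -> y = z.
Proof.
by move=> e; rewrite -(gmul_1l T y) -(gmul_Vl T x) -gmul_assoc e gmul_assoc
  gmul_Vl gmul_1l.
Qed.

Lemma gmul_eq1 (x y : T) : gmul x y = gone -> y = ginv x.
Proof. by move=> e; apply: (@gmul_cancel_l x); rewrite e gmul_Vr. Qed.

Lemma ginvM (x y : T) : ginv (gmul x y) = gmul (ginv y) (ginv x).
Proof.
symmetry; apply: gmul_eq1.
by rewrite -gmul_assoc (gmul_assoc T y) gmul_Vr gmul_1l gmul_Vr.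
Qed.

Lemma ginv1 : ginv (@gone T) = gone.
Proof. by symmetry; apply: gmul_eq1; rewrite gmul_1l. Qed.

Definition lval (l : X * bool) : T := if l.2 then f l.1 else ginv (f l.1).

Definition ev w : T := foldr (fun l a => gmul (lval l) a) gone w.

Lemma ev_cat w1 w2 : ev (w1 ++ w2) = gmul (ev w1) (ev w2).
Proof.
by elim: w1 => [|l w IH] /=; rewrite ?gmul_1l // IH gmul_assoc.
Qed.

Definition winv w := rev [seq (l.1, ~~ l.2) | l <- w].

Lemma ev_winv w : ev (winv w) = ginv (ev w).
Proof.
elim: w => [|[x b] w IH] /=; first by rewrite ginv1.
rewrite /winv /= rev_cons -cats1 ev_cat -/(winv w) IH /= gmul_1r ginvM.
by congr gmul; case: b; rewrite /lval //= ginvK.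
Qed.

End Words.

Arguments ev T [X] f w.

Lemma ev_ext (T : Group) (X : Type) (f g : X -> T) w :
  f =1 g -> ev T f w = ev T g w.
Proof. by move=> fg; elim: w => //= -[x b] w ->; rewrite /lval /= fg. Qed.

Lemma ev_map (T : Group) (X Y : Type) (h : X -> Y) (f : Y -> T) w :
  ev T f [seq (h l.1, l.2) | l <- w] = ev T (f \o h) w.
Proof. by elim: w => //= -[x b] w ->. Qed.

Definition wsubst (X Y : Type) (u : X -> seq (Y * bool)) (w : seq (X * bool)) :=
  flatten [seq (if l.2 then u l.1 else winv (u l.1)) | l <- w].

Lemma ev_wsubst (T : Group) (X Y : Type) (u : X -> seq (Y * bool)) f w :
  ev T f (wsubst u w) = ev T (fun x => ev T f (u x)) w.
Proof.
elim: w => //= -[x b] w IH; rewrite /wsubst /= ev_cat -/(wsubst u w) IH.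
by rewrite /lval /=; case: b => //; rewrite ev_winv.
Qed.

Section ReducedWords.
Variable X : eqType.
Implicit Types (w : seq (X * bool)).

Definition nocancel (l1 l2 : X * bool) := ~~ ((l1.1 == l2.1) && (l1.2 != l2.2)).

Definition redd w := sorted nocancel w.

(** Each letter is cancelled against the head of the already reduced tail. One reduced word serves
    all groups and assignments at once, whence the universal property of free families. *)
Lemma wreduce w : {r | redd r & forall (T : Group) (f : X -> T), ev T f r = ev T f w}.
Proof.
elim: w => [|l w [r rr er]]; first by exists [::].
case: r rr er => [|l' r] rr er; first by exists [:: l] => //= T f; rewrite -er.
have [ll|ll] := boolP (nocancel l l').
  by exists [:: l, l' & r] => [/=|T f]; rewrite ?ll //= -er.
exists r => [|T f]; first by move: rr => /=; case: (r) => //= l2 r2 /andP[].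
rewrite /= -er /= gmul_assoc.
case: l l' ll {rr er} => [x b] [y c]; rewrite /nocancel negbK /= => /andP[/eqP-> bc].
by move: bc; rewrite /lval; case: b; case: c => //= _;
  rewrite ?gmul_Vl ?gmul_Vr gmul_1l.
Qed.

Definition free_fam (G : Group) (x : X -> G) :=
  forall w, redd w -> ev G x w = gone -> w = [::].

(* the universal property of a free basis, stated without homomorphisms *)
Lemma free_fam_univ (G : Group) (x : X -> G) : free_fam x ->
  forall w, ev G x w = gone -> forall (T : Group) (f : X -> T), ev T f w = gone.
Proof.
move=> fx w w1 T f; have [r rr er] := wreduce w.
by rewrite -er (fx r rr) ?er.
Qed.

End ReducedWords.

Lemma redd_map (X Y : eqType) (h : X -> Y) w : injective h ->
  redd [seq (h l.1, l.2) | l <- w] = redd w.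
Proof.
move=> hi; rewrite /redd sorted_map; apply: eq_sorted => -[x b] [y c].
by rewrite /nocancel /= (inj_eq hi).
Qed.

Section SL2.
Local Open Scope ring_scope.

Definition mx2 (R : Type) := (R * R * R * R)%type.

Definition mx2_mul (R : comNzRingType) (A B : mx2 R) : mx2 R :=
  let: (a, b, c, d) := A in let: (a', b', c', d') := B in
  (a * a' + b * c', a * b' + b * d', c * a' + d * c', c * b' + d * d').
Definition mx2_one (R : comNzRingType) : mx2 R := (1, 0, 0, 1).
Definition mx2_adj (R : comNzRingType) (A : mx2 R) : mx2 R :=
  let: (a, b, c, d) := A in (d, - b, - c, a).
Definition mx2_det (R : comNzRingType) (A : mx2 R) : R :=
  let: (a, b, c, d) := A in a * d - b * c.
Definition mx2_map (R S : Type) (h : R -> S) (A : mx2 R) : mx2 S :=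
  let: (a, b, c, d) := A in (h a, h b, h c, h d).

Section Ops.
Variable R : comNzRingType.
Implicit Types A B C : mx2 R.

Lemma mx2_mulA A B C : mx2_mul A (mx2_mul B C) = mx2_mul (mx2_mul A B) C.
Proof.
case: A B C => [[[a b] c] d] [[[a' b'] c'] d'] [[[p q] r] s] /=.
by congr (_, _, _, _); ring.
Qed.

Lemma mx2_mul1l A : mx2_mul (mx2_one R) A = A.
Proof. by case: A => [[[a b] c] d] /=; congr (_, _, _, _); ring. Qed.

Lemma mx2_mul1r A : mx2_mul A (mx2_one R) = A.
Proof. by case: A => [[[a b] c] d] /=; congr (_, _, _, _); ring. Qed.

Lemma mx2_mul_adjl A : mx2_det A = 1 -> mx2_mul (mx2_adj A) A = mx2_one R.
Proof.
by case: A => [[[a b] c] d] /= e; congr (_, _, _, _); rewrite -?e; ring.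
Qed.

Lemma mx2_mul_adjr A : mx2_det A = 1 -> mx2_mul A (mx2_adj A) = mx2_one R.
Proof.
by case: A => [[[a b] c] d] /= e; congr (_, _, _, _); rewrite -?e; ring.
Qed.

Lemma mx2_detM A B : mx2_det (mx2_mul A B) = mx2_det A * mx2_det B.
Proof. by case: A B => [[[a b] c] d] [[[a' b'] c'] d'] /=; ring. Qed.

Lemma mx2_det_adj A : mx2_det (mx2_adj A) = mx2_det A.
Proof. by case: A => [[[a b] c] d] /=; ring. Qed.

Lemma mx2_det1 : mx2_det (mx2_one R) = 1.
Proof. by rewrite /=; ring. Qed.

Definition sl2 := {A : mx2 R | mx2_det A == 1}.

Definition Sl2 A (detA : mx2_det A == 1) : sl2 := exist _ A detA.

Fact sl2_mul_subproof (A B : sl2) : mx2_det (mx2_mul (val A) (val B)) == 1.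
Proof. by rewrite mx2_detM (eqP (valP A)) (eqP (valP B)) mulr1. Qed.
Fact sl2_inv_subproof (A : sl2) : mx2_det (mx2_adj (val A)) == 1.
Proof. by rewrite mx2_det_adj (eqP (valP A)). Qed.
Fact sl2_one_subproof : mx2_det (mx2_one R) == 1.
Proof. by rewrite mx2_det1. Qed.

Definition sl2_mul (A B : sl2) : sl2 := Sl2 (sl2_mul_subproof A B).
Definition sl2_inv (A : sl2) : sl2 := Sl2 (sl2_inv_subproof A).
Definition sl2_one : sl2 := Sl2 sl2_one_subproof.

Definition SL2 : Group.
Proof.
refine (@Build_Group sl2 sl2_mul sl2_inv sl2_one _ _ _ _ _).
- by move=> x y z; apply: val_inj; exact: mx2_mulA.
- by move=> x; apply: val_inj; exact: mx2_mul1l.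
- by move=> x; apply: val_inj; exact: mx2_mul1r.
- by move=> x; apply: val_inj; apply: mx2_mul_adjl; exact/eqP/(valP x).
- by move=> x; apply: val_inj; apply: mx2_mul_adjr; exact/eqP/(valP x).
Defined.

End Ops.

Section Map.
Variables (R S : comNzRingType) (h : {rmorphism R -> S}).

Lemma mx2_mapM A B :
  mx2_map h (mx2_mul A B) = mx2_mul (mx2_map h A) (mx2_map h B).
Proof.
case: A B => [[[a b] c] d] [[[a' b'] c'] d'] /=.
by rewrite !rmorphD !rmorphM.
Qed.

Lemma mx2_map_adj A : mx2_map h (mx2_adj A) = mx2_adj (mx2_map h A).
Proof. by case: A => [[[a b] c] d] /=; rewrite !rmorphN. Qed.

Lemma mx2_map1 : mx2_map h (mx2_one R) = mx2_one S.
Proof. by rewrite /mx2_one /= rmorph0 rmorph1. Qed.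

Fact sl2_map_subproof (A : sl2 R) : mx2_det (mx2_map h (val A)) == 1.
Proof.
case: A => [[[[a b] c] d] /= /eqP e].
by rewrite -!rmorphM -rmorphB e rmorph1.
Qed.

Definition sl2_map (A : SL2 R) : SL2 S := Sl2 (sl2_map_subproof A).

Lemma sl2_map_ev (X : Type) (f : X -> SL2 R) w :
  sl2_map (ev (SL2 R) f w) = ev (SL2 S) (sl2_map \o f) w.
Proof.
elim: w => [|[x b] w IH]; first by apply: val_inj; exact: mx2_map1.
rewrite /= -IH; apply: val_inj; apply: etrans (mx2_mapM _ _) _.
by rewrite /lval; case: b => //=; rewrite mx2_map_adj.
Qed.

End Map.

(* In the basis (1, p), (1, p + 1) this is the matrix [[t, -1], [1, 0]]:
   for large t, it attracts towards the line (1, p) and its inverse towards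
   (1, p + 1). *)
Definition pingpong_mx (R : comNzRingType) (p t : R) : mx2 R :=
  (t * (p + 1) + p + p + 1, - t - 2, t * p * (p + 1) + p ^+ 2 + (p + 1) ^+ 2,
   - (t * p) - p - p - 1).

Fact pingpong_subproof (R : comNzRingType) (p t : R) :
  mx2_det (pingpong_mx p t) == 1.
Proof. by apply/eqP; rewrite /=; ring. Qed.

Definition pingpong (i : nat) : SL2 {poly int} :=
  Sl2 (pingpong_subproof (i.*2%:R%:P) 'X).

(** [c] may be zero: [k] only bounds the degree, so leading terms add up without case
    distinctions. *)
Definition lead (f : {poly int}) k c := f`_k = c /\ forall j, (k < j)%N -> f`_j = 0.

Lemma leadD f g k c d : lead f k c -> lead g k d -> lead (f + g) k (c + d).
Proof.
by move=> [f1 f2] [g1 g2]; split=> [|j kj]; rewrite coefD ?f1 ?g1 // f2 ?g2 ?addr0.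
Qed.

Lemma leadC f k c a : lead f k c -> lead (a%:P * f) k (a * c).
Proof. by move=> [f1 f2]; split=> [|j kj]; rewrite coefCM ?f1 // f2 ?mulr0. Qed.

Lemma leadX f k c : lead f k c -> lead ('X * f) k.+1 c.
Proof.
move=> [f1 f2]; split=> [|j kj]; rewrite coefXM ?f1 //.
by case: j kj => // j kj; rewrite f2.
Qed.

Lemma leadS f k c : lead f k c -> lead f k.+1 0.
Proof. by move=> [f1 f2]; split=> [|j kj]; rewrite f2 // ltnW. Qed.

Lemma lead_eq f g k c d : f = g -> c = d -> lead f k c -> lead g k d.
Proof. by move=> -> ->. Qed.

(** The slope of the line towards which a letter attracts, [2i] or [2i + 1]; distinct letters have
    distinct slopes. *)
Definition target (l : nat * bool) : int := l.1.*2%:R + (~~ l.2)%:R.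

(** The scalar [g] vanishes exactly when the leading vector [(c, d)] lies on the line repelled by
    the letter, which is the line attracting its inverse. *)
Lemma pingpong_step (l : nat * bool) (x y : {poly int}) k c d :
  lead x k c -> lead y k d ->
  let g := if l.2 then (target l + 1) * c - d else d - (target l - 1) * c in
  let: (a, b, c', d') := val (lval pingpong l) in
  lead (a * x + b * y) k.+1 g /\ lead (c' * x + d' * y) k.+1 (g * target l).
Proof.
case: l => i e lx ly.
pose P := i.*2%:R : int.
(* Coordinates of [(x, y)] in the basis (1, P), (1, P + 1), in which the letter acts by [[t, -1],
   [1, 0]] or its inverse. *)
pose al := (P + 1)%:P * x + (-1)%:P * y; pose be := y + (- P)%:P * x.
have lal : lead al k ((P + 1) * c - d).
  by apply: lead_eq (leadD (leadC (P + 1) lx) (leadC (-1) ly)) => //; ring.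
have lbe : lead be k (d - P * c).
  by apply: lead_eq (leadD ly (leadC (- P) lx)) => //; ring.
case: e; rewrite /target /= -/P ?addr0.
  split.
    apply: lead_eq (leadD (leadX lal) (leadD (leadC (-1) (leadS lbe)) (leadS lal))).
      by rewrite /al /be !polyCD !polyCN; ring.
    by ring.
  apply: lead_eq (leadD (leadC P (leadX lal)) (leadD (leadC (- P) (leadS lbe))
    (leadC (P + 1) (leadS lal)))).
    by rewrite /al /be !polyCD !polyCN; ring.
  by ring.
rewrite addrK; split.
  apply: lead_eq (leadD (leadX lbe) (leadD (leadC (-1) (leadS lal)) (leadS lbe))).
    by rewrite /al /be !polyCD !polyCN; ring.
  by ring.
apply: lead_eq (leadD (leadC (P + 1) (leadX lbe)) (leadD (leadC (- (P + 1)) (leadS lal))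
  (leadC P (leadS lbe)))).
  by rewrite /al /be !polyCD !polyCN; ring.
by ring.
Qed.

(** The second column is the image of the vector (0, 1). Its degree grows with each letter, since in
    a reduced word the line reached after [l'] is never the one repelled by [l]. *)
Lemma pingpong_lead l w : redd (l :: w) ->
  exists2 c : int, c != 0 &
  let: (_, b, _, d) := val (ev _ pingpong (l :: w)) in
  lead b (size w).+1 c /\ lead d (size w).+1 (c * target l).
Proof.
elim: w l => [|l' w IH] l.
  move=> _.
  (* The start vector (0, 1) has infinite slope, so it lies on no repelled line. *)
  have l0 : lead 0 0 0 by split=> [|j _]; rewrite coef0.
  have l1 : lead 1 0 1 by split=> [|j j0]; rewrite coef1 //; case: j j0.
  have h := pingpong_step l l0 l1.
  exists (if l.2 then -1 else 1 : int); first by case: l.2.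
  move: h; rewrite /=; case: (val (lval pingpong l)) => [[[a b] c] d] /=.
  by rewrite !mulr0 !sub0r subr0.
case/andP=> ll' rw.
have {IH rw} [c c0] := IH l' rw.
pose A : SL2 {poly int} := ev _ pingpong (l' :: w).
have -> : val (ev _ pingpong [:: l, l' & w]) = mx2_mul (val (lval pingpong l)) (val A) by [].
rewrite -/A; case Ae : (val A) => [[[a' b'] c'] d'] [lb ld].
have := pingpong_step l lb ld.
set g := (if _ then _ else _).
case: (val (lval pingpong l)) => [[[a b] c''] d] [h1 h2].
exists g => //; rewrite /g /target.
case: l l' ll' {g h1 h2 lb ld Ae A} => [i e] [j e'] ll'.
rewrite /nocancel /= in ll' *.
(* The new leading coefficient is, up to sign, [c] times the difference of the slope repelled by [l]
   and the target of [l']. For equal indices the signs agree and the difference is 1 or -1; for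
   distinct indices the slopes lie in the disjoint sets {2i, 2i + 1} and {2j, 2j + 1}. *)
case: eqP ll' => [->|ij] /=.
  rewrite negbK => /eqP->; case: e' => /=.
    by rewrite (_ : _ - _ = c) //; ring.
  by rewrite (_ : _ - _ = c) //; ring.
move=> _; suff: forall z : int, z != 0 -> z * c != 0.
  move=> H; case: e; case: e' => /=.
  - by rewrite (_ : _ - _ = (i.*2%:R + 1 - j.*2%:R) * c); [apply: H; lia|ring].
  - by rewrite (_ : _ - _ = (i.*2%:R - j.*2%:R) * c); [apply: H; lia|ring].
  - by rewrite (_ : _ - _ = (j.*2%:R - i.*2%:R) * c); [apply: H; lia|ring].
  - by rewrite (_ : _ - _ = (j.*2%:R + 1 - i.*2%:R) * c); [apply: H; lia|ring].
by move=> z z0; rewrite mulf_neq0.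
Qed.

Lemma pingpong_free : free_fam pingpong.
Proof.
case=> // l w rw e; have [c c0] := pingpong_lead rw.
by rewrite e /= => -[[]]; rewrite coef0 => c1; rewrite -c1 eqxx in c0.
Qed.

End SL2.

(** * Residual finiteness and the Hopf property *)

Section FiniteQuotients.
Local Open Scope ring_scope.

Definition eval_mod (n : nat) (m : int) : {rmorphism {poly int} -> 'I_n.+2} :=
  (intmul 1 \o horner_eval m)%FUN.

(** A nonzero polynomial has a nonzero value [v] at some integer, and [v] stays nonzero modulo |v| +
    1, which is [n.+2] for n = |v| - 1. *)
Lemma poly_eval_mod_eq0 (f : {poly int}) :
  (forall n m, eval_mod n m f = 0) -> f = 0.
Proof.
move=> f0; have root_f m : f.[m] = 0.
  have [->//|v0] := eqVneq f.[m] 0.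
  have := f0 `|f.[m]|.-1%N m; rewrite /eval_mod /= /horner_eval.
  set v := f.[m] in v0 *; set n := (`|v|.-1)%N => e.
  have : (`|v|%:R : 'I_n.+2) = 0.
    case: (v) e => k /= e; first exact: e.
    by apply/eqP; rewrite -oppr_eq0; apply/eqP.
  have vn : (`|v| < n.+2)%N by rewrite /n; lia.
  move/(congr1 val); rewrite /= Zp_nat /= modn_small // => v00.
  by move: v0; rewrite -absz_eq0 v00.
apply/eqP; apply: contraT => fn0.
pose s := [seq (Posz i) | i <- iota 0 (size f)].
have : (size s < size f)%N.
  apply: max_poly_roots => //; first by apply/allP => z _; apply/rootP.
  by rewrite map_inj_uniq ?iota_uniq // => a b [].
by rewrite size_map size_iota ltnn.
Qed.

(** If every finite reduction of the ping-pong matrices killed [w], the entries of its value would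
    agree with those of the identity at all integers modulo all moduli. *)
Lemma free_residually_finite (w : seq (nat * bool)) : redd w -> w != [::] ->
  exists n (f : nat -> SL2 'I_n.+2), ev _ f w <> gone.
Proof.
move=> rw w0; apply: contrapT => nof; move/eqP: w0; apply.
apply: (pingpong_free rw); apply: val_inj.
have key n m : sl2_map (eval_mod n m) (ev _ pingpong w) = gone.
  apply: contrapT => e; apply: nof; exists n, (sl2_map (eval_mod n m) \o pingpong).
  by rewrite -sl2_map_ev.
have {}key n m := congr1 val (key n m).
case: (ev _ pingpong w) key => [[[[a b] c] d] detA] /= key.
have e g1 g2 : (forall n m, eval_mod n m g1 = eval_mod n m g2) -> g1 = g2.
  move=> g12; apply/eqP; rewrite -subr_eq0; apply/eqP/poly_eval_mod_eq0 => n m.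
  by rewrite rmorphB g12 subrr.
by rewrite /mx2_one; congr (_, _, _, _); apply: e => n m; case: (key n m) => *;
  rewrite ?rmorph0 ?rmorph1.
Qed.

End FiniteQuotients.

(* A family [y] generating the group freely generated by [x] and with no more
   members restricts [Hom(-, S) = S^X] injectively into [S^Y] for each finite
   group [S]; counting makes this a bijection, so that all finite quotients of
   the abstract free group on [Y] are visible through [y]. *)
Theorem free_fam_hopf (X Y : finType) (G : Group) (x : X -> G) (y : Y -> G)
    (u : Y -> seq (X * bool)) (v : X -> seq (Y * bool)) :
  free_fam x -> #|Y| <= #|X| ->
  (forall i, y i = ev G x (u i)) -> (forall j, x j = ev G y (v j)) ->
  free_fam y.
Proof.
move=> fx leYX yu xv w rw w1; apply/eqP; apply: contraT => w0.
pose rk (i : Y) : nat := enum_rank i.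
have rk_inj : injective rk by move=> i j /val_inj/enum_rank_inj.
have [||n [f]] := @free_residually_finite [seq (rk l.1, l.2) | l <- w].
- by rewrite redd_map.
- by case: (w) w0.
rewrite ev_map => fw; pose S := SL2 'I_n.+2.
pose FS : finType := sl2 'I_n.+2.
(* [Phi] restricts the homomorphism given on the basis [x] to the elements [y]; it is injective
   because the [x] are words in the [y]. *)
pose Phi (g : {ffun X -> FS}) : {ffun Y -> FS} :=
  [ffun i => ev S (g : X -> S) (u i)].
have univ := free_fam_univ fx.
have PhiK (g : {ffun X -> FS}) j : ev S (Phi g : Y -> S) (v j) = g j.
  have /gmul_eq1 : gmul (ginv (g j : S)) (ev S (Phi g : Y -> S) (v j)) = gone.
    have -> : ev S (Phi g : Y -> S) (v j) = ev S (g : X -> S) (wsubst u (v j)).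
      by rewrite ev_wsubst; apply: ev_ext => i; rewrite ffunE.
    apply: (univ ((j, false) :: wsubst u (v j))).
    by rewrite /= ev_wsubst (ev_ext _ (fun i => esym (yu i))) -xv gmul_Vl.
  by rewrite ginvK.
have Phi_inj : injective Phi.
  by move=> g1 g2 e; apply/ffunP => j; rewrite -!PhiK e.
have cardS : 1 < #|FS|.
  apply/card_gt1P; exists (ev S (f \o rk) w), (gone : S); split=> //.
  exact/eqP.
have eqXY : #|{ffun X -> FS}| = #|{ffun Y -> FS}|.
  apply/eqP; rewrite eqn_leq (leq_card _ Phi_inj) !card_ffun.
  by rewrite leq_exp2l.
(* By counting, the assignment under which [w] is nontrivial is such a restriction; but a
   homomorphism respects the relation [w] between the [y]. *)
have /codomP[g gE] : ([ffun i => f (rk i)] : {ffun Y -> FS}) \in codom Phi.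
  by apply: inj_card_onto => //; rewrite eqXY.
case: fw; have -> : ev _ (f \o rk) w = ev S (Phi g : Y -> S) w.
  by apply: ev_ext => i; rewrite -gE ffunE.
have -> : ev S (Phi g : Y -> S) w = ev S (g : X -> S) (wsubst u w).
  by rewrite ev_wsubst; apply: ev_ext => i; rewrite ffunE.
apply: univ; rewrite ev_wsubst -w1.
by apply: ev_ext => i; rewrite yu.
Qed.

(** * Hilbert's basis theorem *)

Section Noetherian.
Local Open Scope ring_scope.

Section Ideals.
Variable R : comNzRingType.
Implicit Types (I J : R -> Prop).

Inductive ideal I : R -> Prop :=
| ideal0 : ideal I 0
| ideal_comb a x y : I x -> ideal I y -> ideal I (a * x + y).

Lemma idealD I x y : ideal I x -> ideal I y -> ideal I (x + y).
Proof.
elim=> [|a z t Iz _ IH] Iy; rewrite ?add0r // -addrA.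
by apply: ideal_comb => //; apply: IH.
Qed.

Lemma idealMl I a x : ideal I x -> ideal I (a * x).
Proof.
elim=> [|b z t Iz _ IH]; first by rewrite mulr0; apply: ideal0.
by rewrite mulrDr mulrA; apply: ideal_comb.
Qed.

Lemma ideal_gen I x : I x -> ideal I x.
Proof.
by move=> Ix; rewrite -[x]mul1r -[1 * x]addr0; apply: ideal_comb => //; apply: ideal0.
Qed.

Lemma ideal_sub I J x : (forall y, I y -> ideal J y) -> ideal I x -> ideal J x.
Proof.
move=> IJ; elim=> [|a y z Iy _ IH]; first exact: ideal0.
by apply: idealD => //; apply: idealMl; apply: IJ.
Qed.

Lemma ideal_finite I x : ideal I x ->
  exists s : seq R, (forall y, y \in s -> I y) /\ ideal (fun y => y \in s) x.
Proof.
elim=> [|a y z Iy _ [s [sI Iz]]]; first by exists [::]; split=> //; apply: ideal0.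
exists (y :: s); split.
  by move=> t; rewrite inE => /orP[/eqP->|/sI].
apply: ideal_comb; first exact: mem_head.
by apply: ideal_sub Iz => t ts; apply: ideal_gen; rewrite inE ts orbT.
Qed.

End Ideals.

Lemma ideal_kernel (R S : comNzRingType) (h : {rmorphism R -> S}) (I : R -> Prop) x :
  (forall y, I y -> h y = 0) -> ideal I x -> h x = 0.
Proof.
move=> hI; elim=> [|a y z /hI hy _ hz]; first exact: rmorph0.
by rewrite rmorphD rmorphM hy hz mulr0 addr0.
Qed.

(** [I] is an arbitrary subset and the generators are picked from [I] itself; for equations this
    yields a finite subsystem. *)
Definition noetherian (R : comNzRingType) := forall I : R -> Prop,
  exists s : seq R, (forall x, x \in s -> I x) /\
    forall x, I x -> ideal (fun y => y \in s) x.

Lemma noetherian_field (K : comNzRingType) :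
  (forall x : K, x != 0 -> exists y, y * x = 1) -> noetherian K.
Proof.
move=> inv I; have [[x [Ix x0]]|nox] := pselect (exists x, I x /\ x != 0).
  exists [:: x]; split=> [y|z _]; first by rewrite inE => /eqP->.
  have [y yx] := inv x x0; rewrite -[z]mulr1 -yx mulrA; apply: idealMl.
  by apply: ideal_gen; rewrite inE.
exists [::]; split=> // x Ix; have [->|x0] := eqVneq x 0; first exact: ideal0.
by case: nox; exists x.
Qed.

(** Polynomials [g n] of least degree outside the ideal of their predecessors are chosen one after
    another. Finitely many leading coefficients generate all of them, so that some [g N] can be
    lowered in degree. *)
Theorem hilbert_basis (R : comNzRingType) : noetherian R -> noetherian {poly R}.
Proof.
move=> noeR I; apply: contrapT => noI; pose J := ideal I.
pose good (s : seq {poly R}) p := [/\ J p, ~ ideal (fun y => y \in s) p &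
  forall q, J q -> ~ ideal (fun y => y \in s) q -> (size p <= size q)%N].
have ex_good s : (forall p, p \in s -> J p) -> exists p, good s p.
  move=> sJ; have [p [Jp np]] : exists p, J p /\ ~ ideal (fun y => y \in s) p.
    apply: contrapT => nop; apply: noI.
    (* Were [J] generated by [s], the finitely many elements of [I] needed to express [s] would
       generate it, against [noI]. *)
    have [t [tI st]] : exists t : seq {poly R}, (forall x, x \in t -> I x) /\
        forall x, x \in s -> ideal (fun y => y \in t) x.
      elim: s sJ {nop} => [|p s IH] sJ; first by exists [::].
      have [|t [tI st]] := IH; first by move=> q qs; apply: sJ; rewrite inE qs orbT.
      have [t' [t'I pt']] := ideal_finite (sJ p (mem_head _ _)).
      exists (t ++ t'); split=> x.
        by rewrite mem_cat => /orP[/tI|/t'I].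
      rewrite inE => /orP[/eqP->|/st].
        by apply: ideal_sub pt' => y yt; apply: ideal_gen; rewrite mem_cat yt orbT.
      by apply: ideal_sub => y yt; apply: ideal_gen; rewrite mem_cat yt.
    exists t; split=> // x Ix; apply: ideal_sub st _.
    by apply: contrapT => nx; apply: nop; exists x; split=> //; apply: ideal_gen.
  pose P k := `[< exists p, [/\ J p, ~ ideal (fun y => y \in s) p & size p = k] >].
  have exP : exists k, P k by exists (size p); apply/asboolP; exists p.
  case: (ex_minnP exP) => k0 /asboolP[q [Jq nq sq]] kmin; exists q; split=> // q' Jq' nq'.
  by rewrite sq; apply: kmin; apply/asboolP; exists q'.
pose next s := xget 0 (good s).
pose S := fix S n := if n is m.+1 then rcons (S m) (next (S m)) else [::].
pose g n := next (S n).
have mem_S p n : p \in S n -> exists2 i, (i < n)%N & p = g i.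
  elim: n => // n IH; rewrite /= mem_rcons inE => /orP[/eqP->|/IH[i lt_in ->]].
    by exists n.
  by exists i => //; apply: leqW.
have S_g i n : (i < n)%N -> g i \in S n.
  elim: n => // n IH; rewrite ltnS leq_eqVlt /= mem_rcons inE => /orP[/eqP->|/IH->].
    by rewrite eqxx.
  by rewrite orbT.
have g_good n : good (S n) (g n).
  have [m] := ubnP n; elim: m n => // m IH n /ltnSE le_nm.
  have /ex_good[p gp] : forall p, p \in S n -> J p.
    move=> p /mem_S[i lt_in ->].
    by have [] := IH i (leq_trans lt_in le_nm).
  by rewrite /g /next; case: xgetP => [q -> //|/(_ p)].
have g_mono i n : (i < n)%N -> (size (g i) <= size (g n))%N.
  move=> lt_in; have [_ _] := g_good i; apply; have [Jn nn _] := g_good n => // ii.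
  apply: nn; apply: ideal_sub ii => p /mem_S[j lt_ji ->].
  by apply: ideal_gen; apply: S_g; apply: ltn_trans lt_in.
have [s [sA As]] := noeR (fun x => exists i, x = lead_coef (g i)).
have [N sN] : exists N, forall x, x \in s -> exists2 i, (i < N)%N & x = lead_coef (g i).
  elim: s sA {As} => [|x s IH] sA; first by exists 0%N.
  have [|N sN] := IH; first by move=> y ys; apply: sA; rewrite inE ys orbT.
  have [i xi] := sA x (mem_head _ _); exists (maxn N i.+1) => y.
  rewrite inE => /orP[/eqP->|/sN[j jN ->]].
    by exists i; rewrite // leq_max ltnSn orbT.
  by exists j; rewrite // leq_max jN.
have [JN nN minN] := g_good N; set d := size (g N).
(* [q] combines earlier [g i], shifted by powers of the variable up to the degree of [g N], so as to
   have its leading coefficient. *)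
have [q [Jq iq sq qd]] : exists q, [/\ J q, ideal (fun y => y \in S N) q,
    (size q <= d)%N & q`_d.-1 = lead_coef (g N)].
  have := As (lead_coef (g N)) (ex_intro _ N erefl).
  elim=> [|a x y /sN[i iN ->] _ [q [Jq iq sq qd]]].
    by exists 0; split; rewrite ?size_poly0 ?coef0 //; apply: ideal0.
  exists (a%:P * 'X^(d - size (g i)) * g i + q).
  have [Ji ni _] := g_good i; have le_id := g_mono i N iN.
  have gi0 : (0 < size (g i))%N.
    rewrite lt0n size_poly_eq0; apply/eqP => gi0; apply: ni; rewrite gi0.
    exact: ideal0.
  split.
  - by apply: idealD => //; apply: idealMl.
  - by apply: idealD => //; apply/idealMl/ideal_gen/S_g.
  - apply: leq_trans (size_polyD _ _) _; rewrite geq_max sq andbT.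
    rewrite -mulrA mul_polyC; apply: leq_trans (size_scale_leq _ _) _.
    rewrite mulrC; apply: leq_trans (size_polyMleq _ _) _.
    by rewrite size_polyXn addnS /= subnKC.
  - rewrite coefD qd -mulrA coefCM coefXnM ifF; last by apply/negbTE; lia.
    by congr (_ * _ + _); rewrite lead_coefE; congr nth; lia.
have gN0 : (0 < d)%N.
  rewrite lt0n size_poly_eq0; apply/eqP => gN0; apply: nN; rewrite gN0.
  exact: ideal0.
(* [g N - q] is still outside the ideal of [S N], yet its degree is smaller. *)
have : (d <= size (g N - q)%R)%N.
  apply: minN.
    by apply: idealD => //; rewrite -mulN1r; apply: idealMl.
  by move=> iNq; apply: nN; rewrite -(subrK q (g N)); apply: idealD.
apply/negP; rewrite -ltnNge -(prednK gN0) ltnS; apply/leq_sizeP => j.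
rewrite leq_eqVlt coefB => /orP[/eqP<-|]; first by rewrite qd subrr.
rewrite prednK // => dj; rewrite !nth_default ?subrr //; exact: leq_trans dj.
Qed.

End Noetherian.

(** * Linearity of locally free groups *)

Section Ultrapower.
Local Open Scope ring_scope.
Local Open Scope quotient_scope.
Variables (I : Type) (U : set_system I) (ultraU : UltraFilter U) (k : fieldType).

Definition eqU (f g : I -> k) := `[< U [set i | f i = g i]%classic >].

Fact eqU_refl : reflexive eqU.
Proof. by move=> f; apply/asboolP; apply: filterS filterT => i _. Qed.

Fact eqU_sym : symmetric eqU.
Proof.
by move=> f g; apply/asboolP/asboolP; apply: filterS => i.
Qed.

Fact eqU_trans : transitive eqU.
Proof.
move=> g f h /asboolP fg /asboolP gh; apply/asboolP.
by apply: filterS2 fg gh => i /= -> ->.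
Qed.

Canonical eqU_equiv := EquivRel eqU eqU_refl eqU_sym eqU_trans.

Definition ultrapower := {eq_quot eqU_equiv}.
HB.instance Definition _ := Choice.on ultrapower.
HB.instance Definition _ := EqQuotient.on ultrapower.

Definition ucl (f : I -> k) : ultrapower := \pi_ultrapower f.

Lemma ucl_eq f g : U [set i | f i = g i]%classic -> ucl f = ucl g.
Proof. by move=> fg; apply/eqmodP; apply/asboolP. Qed.

Lemma ucl_eqP f g : ucl f = ucl g -> U [set i | f i = g i]%classic.
Proof. by move/eqmodP/asboolP. Qed.

Lemma ucl_repr x : ucl (repr x) = x.
Proof. exact: reprK. Qed.

Lemma repr_ucl f : U [set i | repr (ucl f) i = f i]%classic.
Proof. by apply: ucl_eqP; rewrite ucl_repr. Qed.

Definition uadd (x y : ultrapower) := ucl (fun i => repr x i + repr y i).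
Definition umul (x y : ultrapower) := ucl (fun i => repr x i * repr y i).
Definition uopp (x : ultrapower) := ucl (fun i => - repr x i).

Lemma uclD f g : uadd (ucl f) (ucl g) = ucl (fun i => f i + g i).
Proof. by apply: ucl_eq; apply: filterS2 (repr_ucl f) (repr_ucl g) => i /= -> ->. Qed.
Lemma uclM f g : umul (ucl f) (ucl g) = ucl (fun i => f i * g i).
Proof. by apply: ucl_eq; apply: filterS2 (repr_ucl f) (repr_ucl g) => i /= -> ->. Qed.
Lemma uclN f : uopp (ucl f) = ucl (fun i => - f i).
Proof. by apply: ucl_eq; apply: filterS (repr_ucl f) => i /= ->. Qed.

Ltac ucl_ring :=
  repeat (let x := fresh in move=> x; rewrite -(ucl_repr x));
  rewrite ?uclN ?(uclD, uclM); congr ucl; apply: funext => i; ring.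

Fact uaddA : associative uadd. Proof. ucl_ring. Qed.
Fact uaddC : commutative uadd. Proof. ucl_ring. Qed.
Fact uadd0 : left_id (ucl (fun=> 0)) uadd. Proof. ucl_ring. Qed.
Fact uaddN : left_inverse (ucl (fun=> 0)) uopp uadd. Proof. ucl_ring. Qed.
Fact umulA : associative umul. Proof. ucl_ring. Qed.
Fact umulC : commutative umul. Proof. ucl_ring. Qed.
Fact umul1 : left_id (ucl (fun=> 1)) umul. Proof. ucl_ring. Qed.
Fact umulD : left_distributive umul uadd. Proof. ucl_ring. Qed.
Fact u1_neq0 : ucl (fun=> 1) != ucl (fun=> 0).
Proof.
apply/eqP => /ucl_eqP e; apply: (@filter_not_empty _ U).
by apply: filterS e => i /= /eqP; rewrite oner_eq0.
Qed.

HB.instance Definition _ :=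
  GRing.isZmodule.Build ultrapower uaddA uaddC uadd0 uaddN.
HB.instance Definition _ :=
  GRing.Zmodule_isComNzRing.Build ultrapower umulA umulC umul1 umulD u1_neq0.

(** Inverses are componentwise: the ultrafilter contains the zero set of a representative or its
    complement, and the former would make [x] zero. *)
Lemma ultrapower_inv (x : ultrapower) : x != 0 -> exists y, y * x = 1.
Proof.
rewrite -(ucl_repr x) => x0; exists (ucl (fun i => (repr x i)^-1)).
rewrite [LHS]uclM; apply: ucl_eq.
have [e|] := in_ultra_setVsetC [set i | repr x i = 0]%classic ultraU.
  by case/eqP: x0; apply: ucl_eq.
by apply: filterS => i /= /eqP; exact: mulVf.
Qed.

End Ultrapower.

(** * Generated subgroups and finite bases *)

Section SubgroupWords.
Variable G : Group.
Implicit Types (S : gset G) (w : seq (G * bool)).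

Lemma word_evalE w : word_eval G w = ev G id w.
Proof. by elim: w => //= -[x b] w ->. Qed.

Lemma reducedE w : reduced G w <-> redd (w : seq ({classic G} * bool)).
Proof.
elim: w => // -[x b] [|[y c] w] IH //.
split=> [[nxy /IH rw]|/andP[nxy /IH rw]].
  by apply/andP; split=> //; apply/negP => /andP[/eqP xy /eqP bc]; exact: nxy.
by split=> // -[/= xy bc]; case/negP: nxy; rewrite /= xy eqxx; apply/eqP.
Qed.

Lemma word_overP S w : word_over G S w <-> forall l, l \in (w : seq ({classic G} * bool)) -> S l.1.
Proof.
split=> [|wS].
  by elim=> // l w' Sl _ IH l'; rewrite inE => /orP[/eqP->|/IH].
elim: w wS => [|l w IH] wS; constructor; first by apply: wS; rewrite mem_head.
by apply: IH => l' wl'; apply: wS; rewrite inE wl' orbT.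
Qed.

Lemma word_over_cat S w1 w2 :
  word_over G S w1 -> word_over G S w2 -> word_over G S (w1 ++ w2).
Proof.
move=> /word_overP h1 /word_overP h2; apply/word_overP => l.
by rewrite mem_cat => /orP[/h1|/h2].
Qed.

Lemma word_over_winv S w : word_over G S w -> word_over G S (winv w).
Proof.
elim: w => [|l w IH] /=; first by constructor.
move=> /List.Forall_cons_iff[Sl /IH wS]; rewrite /winv /= rev_cons -cats1.
by apply: word_over_cat => //; repeat constructor.
Qed.

Lemma word_over_map S (X : Type) (x : X -> G) (w : seq (X * bool)) :
  (forall i, S (x i)) -> word_over G S [seq (x l.1, l.2) | l <- w].
Proof.
move=> xS; elim: w => [|l w IH]; first exact: List.Forall_nil.
by apply/List.Forall_cons_iff; split=> //; apply: xS.
Qed.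

Lemma generated_subgroup S : is_subgroup (generated S).
Proof.
split; first by exists [::]; split=> //; constructor.
split=> [x y [w1 [h1 <-]] [w2 [h2 <-]]|x [w [h <-]]].
  exists (w1 ++ w2); split; first exact: word_over_cat.
  by rewrite !word_evalE ev_cat.
exists (winv w); split; first exact: word_over_winv.
by rewrite !word_evalE ev_winv.
Qed.

Lemma generated_gen S x : S x -> generated S x.
Proof.
move=> Sx; exists [:: (x, true)]; split; first by repeat constructor.
by rewrite /= gmul_1r.
Qed.

Lemma subgroup_ev S (X : Type) (x : X -> G) (w : seq (X * bool)) :
  is_subgroup S -> (forall i, S (x i)) -> S (ev G x w).
Proof.
move=> [S1 [SM SV]] xS; elim: w => //= -[i b] w IH; apply: SM => //.
by rewrite /lval; case: b => /=; [|apply: SV].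
Qed.

Lemma generated_min S T : is_subgroup T -> (forall x, S x -> T x) ->
  forall x, generated S x -> T x.
Proof.
move=> [T1 [TM TV]] ST x [w [wS <-]].
elim: w wS => //= -[y b] w IH /List.Forall_cons_iff[/= /ST Sy /IH Tw]; apply: TM => //.
by rewrite /letter_val; case: b => //=; apply: TV.
Qed.

Definition free_set S :=
  forall w, word_over G S w -> reduced G w -> w <> [::] -> word_eval G w <> gone.

Lemma free_set_fam S (X : eqType) (x : X -> G) :
  free_set S -> injective x -> (forall i, S (x i)) -> free_fam x.
Proof.
move=> fS xi xS w rw w1; apply: contrapT => w0.
have := fS _ (word_over_map w xS); apply.
- by apply/reducedE; rewrite (redd_map (Y := {classic G}) _ xi).
- by case: (w) w0.
- by rewrite word_evalE ev_map.
Qed.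

Definition sset (t : seq {classic G}) : gset G := fun x : {classic G} => x \in t.

Lemma word_over_fam S (X : Type) (x : X -> G) w :
  (forall c, S c -> exists i, c = x i) -> word_over G S w ->
  exists w' : seq (X * bool), w = [seq (x l.1, l.2) | l <- w'].
Proof.
move=> Sx; elim: w => [|[y b] w IH] /=; first by exists [::].
by move=> /List.Forall_cons_iff[/= /Sx[i ->] /IH[w' ->]]; exists ((i, b) :: w').
Qed.

Lemma generated_fam S (X : Type) (x : X -> G) a :
  (forall c, S c -> exists i, c = x i) -> generated S a ->
  exists w : seq (X * bool), a = ev G x w.
Proof.
move=> Sx [w [/(word_over_fam Sx)[w' ->] <-]].
by exists w'; rewrite word_evalE ev_map.
Qed.

Lemma sset_nth (t : seq {classic G}) c : sset t c ->
  exists i : 'I_(size t), c = nth gone t i.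
Proof.
move=> ct; have it : index (c : {classic G}) t < size t by rewrite index_mem.
by exists (Ordinal it); symmetry; exact: (@nth_index {classic G}).
Qed.

Lemma In_mem (s : seq {classic G}) x : List.In x s <-> x \in s.
Proof.
elim: s => //= y s IH; rewrite inE IH.
by split=> [[->|->]|/orP[/eqP->|]]; rewrite ?eqxx ?orbT //; [left|right].
Qed.

(** The basis [X] given by local freeness might be infinite, but finitely many of its elements spell
    the generators [s], and these already generate. *)
Lemma locally_free_fam (s : seq {classic G}) : locally_free G ->
  exists m (x : 'I_m -> G), [/\ free_fam x,
    forall i, generated (sset s) (x i) &
    forall a, generated (sset s) a -> exists w : seq ('I_m * bool), a = ev G x w].
Proof.
move=> lfG; pose A := generated (fun a : G => List.In a s).
have eA : A = generated (sset s).
  by congr generated; apply: funext => a; apply/propext; exact: In_mem.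
have /lfG [_ [X [XA [AX fX]]]] : finitely_generated A.
  by split; [exact: generated_subgroup|exists s].
have [t [tX st]] : exists t : seq {classic G}, (forall a, a \in t -> X a) /\
    forall a, a \in s -> generated (sset t) a.
  have sX a : a \in s -> generated X a by move=> /In_mem sa; apply/AX/generated_gen.
  elim: s sX {A eA XA AX} => [|a s IH] sX; first by exists [::].
  have [|t [tX st]] := IH; first by move=> b bs; apply: sX; rewrite inE bs orbT.
  have [w [/word_overP wX wa]] := sX a (mem_head _ _).
  exists ([seq l.1 | l <- (w : seq ({classic G} * bool))] ++ t); split=> b.
    by rewrite mem_cat => /orP[/mapP[l /wX Xl ->]|/tX].
  rewrite inE => /orP[/eqP->|/st].
    exists w; split=> //; apply/word_overP => l wl; rewrite /sset mem_cat.
    by apply/orP; left; apply: (map_f fst).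
  apply: generated_min; first exact: generated_subgroup.
  by move=> c ct; apply: generated_gen; rewrite /sset mem_cat ct orbT.
pose u := undup t; exists (size u), (fun i => nth gone u i).
have uX (i : 'I_(size u)) : X (nth gone u i).
  by apply: tX; rewrite -mem_undup mem_nth.
split.
- apply: free_set_fam fX _ uX => i j /(introT (@eqP {classic G} _ _)).
  by rewrite nth_uniq ?undup_uniq // => /eqP/val_inj.
- by move=> i; rewrite -eA; apply: XA.
- move=> a; have su : forall b, b \in s -> generated (sset u) b.
    move=> b /st; apply: generated_min; first exact: generated_subgroup.
    by move=> c ct; apply: generated_gen; rewrite /sset mem_undup.
  move=> /(generated_min (@generated_subgroup _) su).
  by apply: generated_fam => c /sset_nth.
Qed.

End SubgroupWords.

Section LinearEmbedding.
Local Open Scope ring_scope.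
Local Notation k := {fraction {poly int}}.

(** A finite basis is sent to ping-pong matrices over the fraction field. [rho] is a total function,
    but a homomorphism only on the subgroup generated by [s]. *)
Lemma locally_free_rep (G : Group) (s : seq {classic G}) : locally_free G ->
  exists rho : G -> SL2 k,
    (forall a b, generated (sset s) a -> generated (sset s) b ->
       rho (gmul a b) = gmul (rho a) (rho b)) /\
    (forall a, generated (sset s) a -> rho a = gone -> a = gone).
Proof.
move=> /(locally_free_fam s)[m [x [fx sx xs]]].
pose frac : {rmorphism {poly int} -> k} := @tofrac {poly int}.
pose e := sl2_map frac \o pingpong \o @nat_of_ord m.
have fe : free_fam e.
  move=> w rw w1.
  have : [seq (nat_of_ord l.1, l.2) | l <- w] = [::]; last by case: (w).
  apply: pingpong_free; first by rewrite redd_map //; exact: ord_inj.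
  rewrite ev_map; apply: val_inj.
  move: w1; rewrite /e -(sl2_map_ev frac (pingpong \o @nat_of_ord m)).
  move=> /(congr1 val); case: (ev _ _ w) => [[[[a b] c] d] detA] /= [].
  have frac_inj p q : frac p = tofrac q -> p = q.
    by move=> /eqP; rewrite tofrac_eq => /eqP.
  move=> aE bE cE dE; rewrite /mx2_one.
  by congr (_, _, _, _); apply: frac_inj; rewrite ?tofrac0 ?tofrac1.
(* [wd a] is some word for [a], the empty one outside the subgroup. Freeness of [x] makes its value
   at [e] independent of the choice; freeness of [e] makes the kernel trivial. *)
have /choice[wd wdE] : forall a, exists w, generated (sset s) a -> a = ev G x w.
  move=> a; have [/xs[w aw]|na] := pselect (generated (sset s) a).
    by exists w.
  by exists [::].
have univ := free_fam_univ fx; have univ' := free_fam_univ fe.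
exists (fun a => ev _ e (wd a)); split=> [a b ga gb|a ga].
  have gab : generated (sset s) (gmul a b).
    by have [_ [gM _]] := @generated_subgroup G (sset s); apply: gM.
  have /gmul_eq1 : gmul (ev _ e (winv (wd a ++ wd b))) (ev _ e (wd (gmul a b))) = gone.
    rewrite -ev_cat; apply: univ; rewrite ev_cat ev_winv ev_cat.
    by rewrite -!wdE // gmul_Vl.
  by rewrite ev_winv ginvK ev_cat.
by move=> /univ'/(_ G x); rewrite -wdE.
Qed.

Section MatrixUltrapower.
Variables (I : Type) (U : set_system I) (ultraU : UltraFilter U).
Notation K := (ultrapower ultraU k).

Definition mx2_ucl (F : I -> mx2 k) : mx2 K :=
  (ucl ultraU (fun i => (F i).1.1.1), ucl ultraU (fun i => (F i).1.1.2),
   ucl ultraU (fun i => (F i).1.2), ucl ultraU (fun i => (F i).2)).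

Lemma mx2_uclM F F' :
  mx2_mul (mx2_ucl F) (mx2_ucl F') = mx2_ucl (fun i => mx2_mul (F i) (F' i)).
Proof.
rewrite /mx2_ucl /=; congr (_, _, _, _);
  rewrite -![ucl _ _ * ucl _ _]/(umul _ _) !uclM [LHS]uclD;
  congr ucl; apply: funext => i;
  by case: (F i) (F' i) => [[[a b] c] d] [[[a' b'] c'] d'].
Qed.

Lemma mx2_ucl_det F : mx2_det (mx2_ucl F) = ucl ultraU (fun i => mx2_det (F i)).
Proof.
rewrite /mx2_ucl /=.
rewrite -![ucl _ _ * ucl _ _]/(umul _ _) !uclM -[- ucl _ _]/(uopp _) uclN [LHS]uclD.
by congr ucl; apply: funext => i; case: (F i) => [[[a b] c] d].
Qed.

Lemma mx2_ucl_eq F F' : U [set i | F i = F' i]%classic -> mx2_ucl F = mx2_ucl F'.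
Proof.
by move=> e; congr (_, _, _, _); apply: ucl_eq; apply: filterS e => i /= ->.
Qed.

Lemma mx2_ucl_eqP F F' : mx2_ucl F = mx2_ucl F' -> U [set i | F i = F' i]%classic.
Proof.
move=> [/ucl_eqP e1 /ucl_eqP e2 /ucl_eqP e3 /ucl_eqP e4].
apply: filterS2 (filterI e1 e2) (filterI e3 e4) => i /=.
by case: (F i) (F' i) => [[[a b] c] d] [[[a' b'] c'] d'] /= [-> ->] [-> ->].
Qed.

Fact sl2_ucl_subproof (F : I -> SL2 k) :
  mx2_det (mx2_ucl (fun i => val (F i))) == 1.
Proof.
rewrite mx2_ucl_det; apply/eqP/ucl_eq; apply: filterS filterT => i _.
exact/eqP/(valP (F i)).
Qed.

Definition sl2_ucl (F : I -> SL2 k) : SL2 K := Sl2 (sl2_ucl_subproof F).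

End MatrixUltrapower.

(** An element goes to the class of its images over all finite lists [s]. Each required property
    concerns finitely many elements, hence holds at all lists containing them, and the ultrafilter
    is chosen to contain all these cones. *)
Theorem locally_free_linear (G : Group) : locally_free G ->
  exists K : comNzRingType, (forall x : K, x != 0 -> exists y, y * x = 1) /\
  exists iota : G -> SL2 K,
    (forall a b, iota (gmul a b) = gmul (iota a) (iota b)) /\
    (forall a, iota a = gone -> a = gone).
Proof.
move=> lfG.
pose cone (s : seq {classic G}) := [set t : seq {classic G} | {subset s <= t}]%classic.
have /ultraFilterLemma[U [ultraU coneU]] : ProperFilter (filter_from [set: _] cone).
  apply: filter_from_proper; last by move=> s _; exists s => /= a.
  apply: filter_fromT_filter; first by exists [::].
  move=> s t; exists (s ++ t) => r /= str.
  by split=> a ar; apply: str; rewrite mem_cat ar ?orbT.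
have U_cone s : U (cone s) by apply: coneU; exists s.
have /choice[rho rhoP] := fun s => @locally_free_rep G s lfG.
exists (ultrapower ultraU k); split; first exact: ultrapower_inv.
exists (fun a => sl2_ucl ultraU (fun s => rho s a)); split=> [a b|a].
  apply: val_inj; rewrite /= [RHS]mx2_uclM; apply: mx2_ucl_eq.
  apply: filterS (U_cone [:: a; b]) => s sab /=.
  rewrite -[RHS]/(val (gmul (rho s a) (rho s b))).
  have [-> //] := rhoP s; by apply: generated_gen; apply: sab; rewrite !inE eqxx ?orbT.
move=> /(congr1 val) /= e.
have {}e : U [set s | val (rho s a) = mx2_one k]%classic.
  by apply: (@mx2_ucl_eqP _ _ ultraU _ (fun=> mx2_one k)); rewrite e.
have [s /= [sa rs]] := filter_ex (filterI (U_cone [:: a]) e).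
have [_] := rhoP s; apply; first by apply: generated_gen; apply: sa; rewrite !inE.
exact: val_inj.
Qed.

End LinearEmbedding.

(** * Equations in one variable *)

Section Equations.
Variable G : Group.
Implicit Types (P : gset G) (t : G) (e : seq (option G * bool)).

(* A one-variable equation over [G] is a word with letters in [option G], where
   [None] is the unknown. *)
Definition eq_at t (o : option G) : G := if o is Some c then c else t.
Definition solves t e := ev G (eq_at t) e = gone.
Definition eq_over P e := forall c b, List.In (Some c, b) e -> P c.

Definition eq_closed P := forall es : seq (seq (option G * bool)),
  (forall e, List.In e es -> eq_over P e) ->
  (exists t, forall e, List.In e es -> solves t e) ->
  exists2 t, P t & forall e, List.In e es -> solves t e.

Local Open Scope ring_scope.

Section Coordinates.
Variables (K : comNzRingType) (iota : G -> SL2 K).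
Hypothesis iotaM : forall a b, iota (gmul a b) = gmul (iota a) (iota b).
Hypothesis iota_inj : forall a, iota a = gone -> a = gone.

Lemma iota1 : iota gone = gone.
Proof. by apply: (@gmul_cancel_l _ (iota gone)); rewrite -iotaM gmul_1l gmul_1r. Qed.

Lemma iotaV a : iota (ginv a) = ginv (iota a).
Proof. by apply: gmul_eq1; rewrite -iotaM gmul_Vr iota1. Qed.

Local Notation K4 := {poly {poly {poly {poly K}}}}.

Definition const4 (c : K) : K4 := c%:P%:P%:P%:P.

(** The four variables are the entries of the unknown, the outermost being the upper left one. The
    inverse is written as the adjugate, so equations have polynomial entries. *)
Definition unknown_mx : mx2 K4 := ('X, 'X%:P, 'X%:P%:P, 'X%:P%:P%:P).

Definition letter_mx (l : option G * bool) : mx2 K4 :=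
  let A := if l.1 is Some c then mx2_map const4 (val (iota c)) else unknown_mx in
  if l.2 then A else mx2_adj A.

Definition equation_mx e : mx2 K4 :=
  foldr (fun l A => mx2_mul (letter_mx l) A) (mx2_one _) e.

Definition eval4 (A : mx2 K) : {rmorphism K4 -> K} :=
  (horner_eval A.2 \o horner_eval A.1.2%:P \o horner_eval A.1.1.2%:P%:P
   \o horner_eval A.1.1.1%:P%:P%:P)%FUN.

Lemma eval4_const A c : eval4 A (const4 c) = c.
Proof. by rewrite /eval4 /= /horner_eval !hornerC. Qed.

Lemma eval4_unknown A : mx2_map (eval4 A) unknown_mx = A.
Proof.
case: A => [[[a b] c] d]; rewrite /unknown_mx /eval4 /= /horner_eval.
by rewrite !(hornerC, hornerX).
Qed.

Lemma equation_mxE t e :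
  mx2_map (eval4 (val (iota t))) (equation_mx e) = val (iota (ev G (eq_at t) e)).
Proof.
elim: e => [|[o b] e IH]; first by rewrite [LHS]mx2_map1 /= iota1.
rewrite [LHS]mx2_mapM IH [ev _ _ _]/= iotaM; congr mx2_mul.
have oE : mx2_map (eval4 (val (iota t))) (letter_mx (o, true)) = val (iota (eq_at t o)).
  case: o => [c|]; last exact: eval4_unknown.
  rewrite /letter_mx /=; case: (val (iota c)) => [[[a' b'] c'] d'].
  by congr (_, _, _, _); exact: eval4_const.
case: b => //; rewrite /letter_mx /= mx2_map_adj -/(letter_mx (o, true)).
by rewrite [mx2_map _ _]oE /lval /= iotaV.
Qed.

Definition eq_polys e : seq K4 :=
  let: (a, b, c, d) := equation_mx e in [:: a - 1; b; c; d - 1].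

Lemma solvesP t e : solves t e <->
  forall p, p \in eq_polys e -> eval4 (val (iota t)) p = 0.
Proof.
have := equation_mxE t e; rewrite /solves /eq_polys.
move: (eval4 _) => s; case: (equation_mx e) => [[[a b] c] d] /= E; split.
  move=> e1; move: E; rewrite e1 iota1 => -[a1 b0 c0 d1] p; rewrite !inE.
  by case/or4P => /eqP ->; rewrite ?rmorphB ?a1 ?d1 ?rmorph1 ?subrr.
move=> ep; apply: iota_inj; apply: val_inj; rewrite -[LHS]E.
have s1 p : s (p - 1) = 0 -> s p = 1.
  by move=> /eqP; rewrite rmorphB rmorph1 subr_eq0 => /eqP.
by congr (_, _, _, _); [apply: s1| | |apply: s1]; apply: ep; rewrite !inE eqxx ?orbT.
Qed.

End Coordinates.

(** The polynomials of all equations over [P] satisfied by [g] lie in the ideal of finitely many of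
    them. These come from a finite system solved by [g], hence by some [g'] in [P], at which the
    whole ideal vanishes. *)
Theorem locally_free_eq_noetherian P g : locally_free G -> eq_closed P ->
  exists2 g', P g' & forall e, eq_over P e -> solves g e -> solves g' e.
Proof.
move=> /locally_free_linear[K [invK [iota [iotaM iota_inj]]]] clP.
have noeK : noetherian {poly {poly {poly {poly K}}}}.
  by do 4! apply: hilbert_basis; apply: noetherian_field.
have [s [sJ Js]] := noeK (fun p => exists e,
  [/\ eq_over P e, solves g e & p \in eq_polys iota e]).
have [es [esP ges ses]] : exists es, [/\ forall e, List.In e es -> eq_over P e,
    forall e, List.In e es -> solves g e &
    forall p, p \in s -> exists2 e, List.In e es & p \in eq_polys iota e].
  elim: s sJ {Js} => [|p s IH] sJ; first by exists [::].
  have [|es [esP ges ses]] := IH; first by move=> q qs; apply: sJ; rewrite inE qs orbT.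
  have [e [eP ge pe]] := sJ p (mem_head _ _).
  exists (e :: es); split=> [e' [<-|/esP]|e' [<-|/ges]|q] //.
  rewrite inE => /orP[/eqP->|/ses[e' ee' qe']]; first by exists e => //; left.
  by exists e' => //; right.
have [g' Pg' g'es] := clP es esP (ex_intro _ g ges).
exists g' => // e eP ge; apply/(solvesP iotaM iota_inj) => p pe.
apply: ideal_kernel (Js p _); last by exists e.
move=> y /ses[e' ee' ye'].
by have /(solvesP iotaM iota_inj)/(_ y ye') := g'es _ ee'.
Qed.

End Equations.

(** * Enlarging a free set by one element *)

Section Extension.
Variable G : Group.
Hypothesis lfG : locally_free G.

(** The last hypothesis is the retraction sending [h] to 1. If the group generated by [x] and [h]
    had rank at most [#|X|], the Hopf property would make this retraction injective and [h]
    trivial. *)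
Lemma free_fam_extend (X : finType) (x : X -> G) (h : G) :
  free_fam x -> h <> gone ->
  (forall w, ev G (oapp x h) w = gone -> ev G (oapp x gone) w = gone) ->
  free_fam (oapp x h).
Proof.
move=> fx h1 ret; pose s : seq {classic G} := [seq oapp x h o | o <- enum {:option X}].
have sE c : sset s c -> exists o, c = oapp x h o by move=> /mapP[o _ ->]; exists o.
have gs o : generated (sset s) (oapp x h o).
  by apply: generated_gen; apply/mapP; exists o; rewrite ?mem_enum.
have [m [z [fz zs sz]]] := locally_free_fam s lfG.
have /choice[v vE] i := generated_fam sE (zs i).
have /choice[u uE] o := sz _ (gs o).
(* For [m] above [#|X|], the [#|X| + 1] generators are no more numerous than the basis [z], hence
   free. *)
have [le_mX|lt_Xm] := leqP m #|X|; last first.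
  by apply: (free_fam_hopf fz _ uE vE); rewrite card_option card_ord.
(* The image of the basis [z] under the retraction: at most [#|X|] elements, generating the same
   group as [x]. *)
pose y i := ev G (oapp x gone) (v i).
have yu o : oapp x gone o = ev G y (u o).
  have /gmul_eq1 -> : gmul (ginv (oapp x gone o)) (ev G y (u o)) = gone; last first.
    by rewrite ginvK.
  have := ret ((o, false) :: wsubst v (u o)); rewrite /= !ev_wsubst; apply.
  by rewrite /lval /= (ev_ext _ (fun i => esym (vE i))) -uE gmul_Vl.
pose del (o : option X) := if o is Some j then [:: (j, true)] else [::].
have yx i : y i = ev G x (wsubst del (v i)).
  by rewrite ev_wsubst; apply: ev_ext => -[j|] //=; rewrite gmul_1r.
have fy : free_fam y.
  apply: (@free_fam_hopf _ _ _ x y (fun i => wsubst del (v i)) (fun j => u (Some j))) => //.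
    by rewrite card_ord.
  by move=> j; rewrite -(yu (Some j)).
(* The word [u None] has value 1 at the free family [y], hence at [z] too, where its value is
   [h]. *)
case: h1; rewrite -[h]/(oapp x h None) uE; apply: (free_fam_univ fy).
by rewrite -yu.
Qed.

Lemma free_set_extend (P S : gset G) g : eq_closed P ->
  (forall a, S a -> P a) -> free_set S -> ~ P g ->
  exists2 h, ~ S h & free_set (fun a => S a \/ a = h).
Proof.
move=> clP SP fS nPg; have [g' Pg' gg'] := locally_free_eq_noetherian g lfG clP.
pose h := gmul (ginv g') g.
have h1 : h <> gone by move=> /gmul_eq1; rewrite ginvK => gE; apply: nPg; rewrite gE.
have nSh : ~ S h.
  move=> Sh; apply: h1.
  (* The equation t^-1 g' h = 1 is solved by [g]; with [h] in [S] it is over [P], so [g'] solves it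
     as well and h = 1. *)
  have /gg' : eq_over P [:: (None, false); (Some g', true); (Some h, true)].
    by move=> c b [//|[[<- _]//|[[<- _]|//]]]; apply: SP.
  rewrite /solves /= /lval /= gmul_1r !gmul_assoc gmul_Vl gmul_1l; apply.
  by rewrite -!gmul_assoc (gmul_assoc _ g') gmul_Vr gmul_1l gmul_Vl.
exists h => // w wS rw w0 w1.
pose t : seq {classic G} :=
  undup [seq l.1 | l <- (w : seq ({classic G} * bool)) & l.1 != (h : {classic G})].
have tS c : c \in t -> S c.
  rewrite mem_undup => /mapP[l]; rewrite mem_filter => /andP[/eqP lh lw ->].
  by move/word_overP: wS => /(_ l lw)[].
pose x (i : 'I_(size t)) := nth gone t i.
have xS i : S (x i) by apply: tS; rewrite mem_nth.
have x_inj : injective x.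
  move=> i j /(introT (@eqP {classic G} _ _)).
  by rewrite nth_uniq ?undup_uniq // => /eqP/val_inj.
have fxh : free_fam (oapp x h).
  apply: free_fam_extend => //; first exact: free_set_fam fS x_inj xS.
  (* Reading the letter of [h] as g'^-1 t turns a relation into an equation over [P]: at [g] it
     gives back [h], at [g'] it replaces [h] by 1. *)
  move=> v; pose tr (o : option 'I_(size t)) : seq (option G * bool) :=
    if o is Some i then [:: (Some (x i), true)] else [:: (Some g', false); (None, true)].
  have trP : eq_over P (wsubst tr v).
    move=> c b; rewrite /wsubst; elim: v => //= -[o b'] v IH.
    move=> /List.in_app_iff[|//].
    case: o b' => [i|] [] /=; rewrite /winv /=.
    - by move=> [[<- _]|//]; apply/SP/xS.
    - by move=> [[<- _]|//]; apply/SP/xS.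
    - by move=> [[<- _]|[//|//]].
    - by move=> [//|[[<- _]|//]].
  have trE t' : ev G (eq_at t') (wsubst tr v) = ev G (oapp x (gmul (ginv g') t')) v.
    by rewrite ev_wsubst; apply: ev_ext => -[i|] /=; rewrite gmul_1r.
  move=> v1; have := gg' _ trP; rewrite /solves !trE gmul_Vl; exact.
have xh_inj : injective (oapp x h).
  move=> [i|] [j|] //=.
  - by move=> /x_inj ->.
  - by move=> xi; case: nSh; rewrite -xi.
  - by move=> xj; case: nSh; rewrite xj.
have [w' wE] : exists w', w = [seq (oapp x h l.1, l.2) | l <- w'].
  apply: (@word_over_fam _ (fun c => c = h \/ sset t c)).
    by move=> c [->|/sset_nth[i ->]]; [exists None|exists (Some i)].
  apply/word_overP => l lw; have [|lh] := pselect (l.1 = h); first by left.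
  right; rewrite /sset mem_undup; apply/mapP; exists l => //.
  by rewrite mem_filter lw andbT; apply/eqP.
case: w0; rewrite wE; suff -> : w' = [::] by [].
apply: fxh.
  by rewrite -(redd_map (Y := {classic G}) _ xh_inj) -[map _ _]wE; apply/reducedE.
by rewrite -w1 word_evalE wE ev_map.
Qed.

End Extension.

(** * Free products *)

Section UniqueReducedWords.
Variables (G : Group) (S : gset G).
Hypothesis fS : free_set S.

Lemma redd_winv (X : eqType) (w : seq (X * bool)) : redd (winv w) = redd w.
Proof.
rewrite /redd /winv rev_sorted sorted_map; apply: eq_sorted => -[x b] [y c].
by rewrite /nocancel /= eq_sym; case: b; case: c.
Qed.

Lemma redd_cat (X : eqType) (w1 w2 : seq (X * bool)) l :
  redd (w1 ++ l :: w2) =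
  [&& redd w1, if w1 is _ :: _ then nocancel (last l w1) l else true & redd (l :: w2)].
Proof.
by case: w1 => //= l1 w1; rewrite cat_path /=.
Qed.

(** Common first letters cancel; if the first letters differ, [winv w1 ++ w2] is a nonempty reduced
    word, so its value is not 1. *)
Lemma free_set_word_inj w1 w2 : word_over G S w1 -> word_over G S w2 ->
  reduced G w1 -> reduced G w2 -> ev G id w1 = ev G id w2 -> w1 = w2.
Proof.
elim: w1 w2 => [|l1 w1 IH] [|l2 w2] S1 S2 r1 r2 // e.
- by case: (@fS _ S2 r2) => //; rewrite word_evalE -e.
- by case: (@fS _ S1 r1) => //; rewrite word_evalE e.
have /List.Forall_cons_iff[_ S1'] := S1; have /List.Forall_cons_iff[_ S2'] := S2.
have tail (l : G * bool) w : reduced G (l :: w) -> reduced G w by case: w => // l' w [].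
have [l12|l12] := pselect (l1 = l2).
  move: e; rewrite l12 => /gmul_cancel_l /IH -> //; [exact: tail r1|exact: tail r2].
case: (@fS (winv (l1 :: w1) ++ l2 :: w2)).
- by apply: word_over_cat => //; apply: word_over_winv.
- apply/reducedE; move/reducedE: r1 => r1; move/reducedE: r2 => r2.
  rewrite (@redd_cat {classic G}) (@redd_winv {classic G}) r1 r2 andbT /=.
  rewrite /winv /= rev_cons; case: (rev _) => [|l w] /=; rewrite ?last_rcons /nocancel /=;
    apply/negP => /andP[/eqP e1 e2]; apply: l12;
    by case: l1 l2 e1 e2 {e S1 S2 r1 r2 S1' S2'} => [x []] [y []] //= ->.
- by rewrite /winv /= rev_cons -cats1 -catA; case: (rev _).
- by rewrite word_evalE ev_cat ev_winv e gmul_Vl.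
Qed.

End UniqueReducedWords.

(** Each [r] is the longest prefix with letters in [a]. This recovers the first syllable of a normal
    form from its spelling. *)
Lemma cat_split (T : Type) (a : pred T) (r1 r2 f1 f2 : seq T) :
  all a r1 -> all a r2 -> ~~ has a (take 1 f1) -> ~~ has a (take 1 f2) ->
  r1 ++ f1 = r2 ++ f2 -> r1 = r2 /\ f1 = f2.
Proof.
elim: r1 r2 => [|x r1 IH] [|y r2] //=.
- by case: f1 => //= z f1 _ /andP[ay _] + _ [zy _]; rewrite take0 orbF zy ay.
- by case: f2 {IH} => //= z f2 /andP[ax _] _ _ + [xz _]; rewrite take0 orbF -xz ax.
by move=> /andP[_ h1] /andP[_ h2] h3 h4 [-> /IH[] // -> ->].
Qed.

Section FreeProduct.
Variables (G : Group) (Y X : gset G).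
Hypothesis YX : forall a, Y a -> ~ X a.
Hypothesis fS : free_set (fun a => Y a \/ X a).

Let side (b : bool) : gset G := if b then Y else X.

Lemma reduced_spelling (Z : gset G) g : generated Z g ->
  exists w, [/\ word_over G Z w, reduced G w & ev G id w = g].
Proof.
move=> [w [wZ <-]]; pose T := {x : {classic G} | `[< Z x >]}.
have [|w' ->] := @word_over_fam G Z T sval w _ wZ.
  by move=> c Zc; exists (exist _ c (asboolT Zc)).
have [r rr er] := wreduce w'; exists [seq (sval l.1 : G, l.2) | l <- r]; split.
- by apply: word_over_map => -[c Zc]; exact/asboolP.
- by apply/reducedE; rewrite (redd_map (Y := {classic G}) _ val_inj).
- by rewrite word_evalE !ev_map er.
Qed.

(** Spelling each syllable by a reduced word over its own side turns a normal form into a reduced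
    word, as adjacent syllables have disjoint alphabets. Uniqueness of reduced words gives
    uniqueness of normal forms. *)
Theorem free_set_free_product : is_free_product (generated Y) (generated X).
Proof.
have /choice[rd rdE] : forall p : bool * G, exists r, generated (side p.1) p.2 ->
    [/\ word_over G (side p.1) r, reduced G r & ev G id r = p.2].
  move=> [b g]; have [/reduced_spelling[r rE]|n] := pselect (generated (side b) g).
    by exists r.
  by exists [::].
pose flat (w : seq (bool * G)) := flatten [seq rd p | p <- w].
pose tag (b : bool) (l : {classic G} * bool) := `[< side b l.1 >].
have side_neq b a : side (~~ b) a -> ~ side b a.
  by case: b => /= h1 h2; [apply: YX h2 h1|apply: YX h1 h2].
have nfE p w : normal_form G (generated Y) (generated X) (p :: w) ->
    [/\ generated (side p.1) p.2, p.2 <> gone,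
        normal_form G (generated Y) (generated X) w &
        if w is q :: _ then q.1 = ~~ p.1 else True].
  move=> [/List.Forall_cons_iff[[gp np] hw] al]; split=> //.
  - by rewrite /side; case: p.1 gp.
  - by split=> //; case: w al hw => // q w [].
  - by case: w al hw => // q w [pq _] _; case: q.1 p.1 pq => -[].
have rdne p : generated (side p.1) p.2 -> p.2 <> gone -> exists l r, rd p = l :: r.
  by move=> /rdE[_ _ <-]; case: (rd p) => // l r _; exists l, r.
have flat_head p w : normal_form G (generated Y) (generated X) (p :: w) ->
    exists l r, flat (p :: w) = l :: r /\ side p.1 l.1.
  move=> /nfE[gp np _ _]; have [l [r E]] := rdne _ gp np.
  exists l, (r ++ flat w); rewrite /flat /= E; split=> //.
  by have [+ _ _] := rdE _ gp; rewrite E => /List.Forall_cons_iff[].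
have tag_rd p : generated (side p.1) p.2 -> all (tag p.1) (rd p).
  by move=> /rdE[/word_overP h _ _]; apply/allP => l /h; exact: asboolT.
have tag_flat p w : normal_form G (generated Y) (generated X) (p :: w) ->
    ~~ has (tag p.1) (take 1 (flat w)).
  case: w => // q w /nfE[_ _ nfw qp]; have [l [r [-> sl]]] := flat_head _ _ nfw.
  by rewrite /= take0 orbF; apply/asboolPn; apply: side_neq; rewrite -qp.
have flatP w : normal_form G (generated Y) (generated X) w ->
    [/\ word_over G (fun a => Y a \/ X a) (flat w), reduced G (flat w) &
        ev G id (flat w) = nf_eval G w].
  elim: w => [|p w IH] nfw; first by split=> //; exact: List.Forall_nil.
  have [gp np /IH[Sw rw ew] _] := nfE _ _ nfw.
  have [Sp rp ep] := rdE _ gp; rewrite /flat /=; split.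
  - apply: word_over_cat => //; apply: List.Forall_impl Sp => l.
    by rewrite /side; case: p.1; [left|right].
  - have := tag_flat _ _ nfw; have := tag_rd _ gp.
    move: rw rp; rewrite /flat; case: (flatten _) => [|l f]; first by rewrite cats0.
    move=> /reducedE rw /reducedE rp trd /=; rewrite take0 orbF => ntl.
    apply/reducedE; rewrite (@redd_cat {classic G}) rw rp /= andbT.
    case: (rd p) trd => // l' r /allP trd; apply/negP => /andP[/eqP ll' _].
    case/negP: ntl; rewrite /tag -ll'.
    exact: (trd _ (mem_last _ _)).
  - by rewrite ev_cat ep ew.
split=> [w1 w2 nf1 nf2 e|g].
  have : flat w1 = flat w2.
    have [S1 r1 e1] := flatP _ nf1; have [S2 r2 e2] := flatP _ nf2.
    by apply: (free_set_word_inj fS); rewrite ?e1 ?e2.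
  elim: w1 w2 nf1 nf2 {e} => [|p1 w1 IH] [|p2 w2] nf1 nf2 //.
  - by have [l [r [-> _]]] := flat_head _ _ nf2.
  - by have [l [r [-> _]]] := flat_head _ _ nf1.
  move=> E; have p12 : p1.1 = p2.1.
    have [l1 [r1 [E1 s1]]] := flat_head _ _ nf1.
    have [l2 [r2 [E2 s2]]] := flat_head _ _ nf2.
    move: E; rewrite E1 E2 => -[l12 _]; rewrite -l12 in s2.
    have := side_neq p1.1 l1.1; move: s1 s2; case: p1.1; case: p2.1 => //= h1 h2 h;
      by case: (h h2 h1).
  have [gp1 _ nf1' _] := nfE _ _ nf1; have [gp2 _ nf2' _] := nfE _ _ nf2.
  have [||||rd12 fl12] := @cat_split _ (tag p1.1) _ _ _ _ _ _ _ _ E.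
  - exact: tag_rd.
  - by rewrite p12; apply: tag_rd.
  - exact: tag_flat nf1.
  - by rewrite p12; apply: tag_flat nf2.
  congr (_ :: _); last exact: IH.
  have [_ _ e1] := rdE _ gp1; have [_ _ e2] := rdE _ gp2.
  by rewrite [p1]surjective_pairing p12 -e1 rd12 e2 -surjective_pairing.
have subY := @generated_subgroup G Y; have subX := @generated_subgroup G X.
have sub b : is_subgroup (generated (side b)) by case: b.
split=> [[w [wS <-]]|[w [nfw <-]]] {g}; last first.
  have [_ [JM _]] := @generated_subgroup G (fun x => generated Y x \/ generated X x).
  elim: w nfw => [|p w IH] nfw /=; first by exists [::]; split=> //; exact: List.Forall_nil.
  have [gp _ nfw' _] := nfE _ _ nfw; apply: JM; last exact: IH.
  by apply: generated_gen; move: gp; rewrite /side; case: p.1; [left|right].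
(* Left multiplication on normal forms: a nontrivial [g] becomes a new syllable, merges with the
   first one, or cancels it. *)
have nf_cons b g v : generated (side b) g ->
    normal_form G (generated Y) (generated X) v ->
    exists v', normal_form G (generated Y) (generated X) v' /\
               nf_eval G v' = gmul g (nf_eval G v).
  move=> gb nfv; have [->|g1] := pselect (g = gone).
    by exists v; rewrite gmul_1l.
  have nf1 c g' u : generated (side c) g' -> g' <> gone ->
      normal_form G (generated Y) (generated X) u ->
      (if u is q :: _ then c <> q.1 else True) ->
      normal_form G (generated Y) (generated X) ((c, g') :: u).
    move=> gc g'1 [nu au] hu; split; last by case: u au hu {nu} => // q u.
    by apply/List.Forall_cons_iff; split=> //; split=> //; move: gc; rewrite /side; case: c {hu}.
  case: v nfv => [|q v] nfv.
    by exists [:: (b, g)]; split=> //; apply: nf1 => //; exact: nfv.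
  have [bq|bq] := eqVneq b q.1; last first.
    by exists [:: (b, g), q & v]; split=> //; apply: nf1 => //; exact/eqP.
  have [gq q1 nfv' hv] := nfE _ _ nfv.
  have [gq1|gq1] := pselect (gmul g q.2 = gone).
    by exists v; split=> //=; rewrite gmul_assoc gq1 gmul_1l.
  exists ((b, gmul g q.2) :: v); split; last by rewrite /= gmul_assoc.
  apply: nf1 => //.
    by have [_ [sM _]] := sub b; apply: sM => //; rewrite bq.
  by case: v hv {nfv nfv'} => // q' v ->; rewrite bq; case: q.1.
elim: w wS => [|[a c] w IH] wS /=.
  by exists [::]; split=> //; split=> //; exact: List.Forall_nil.
move: wS => /List.Forall_cons_iff[/= Sa /IH[v [nfv <-]]].
have [b gb] : exists b, generated (side b) (letter_val G (a, c)).
  case: Sa => ga; [exists true|exists false]; rewrite /letter_val /=; case: c => //;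
    [have [_ [_ sV]] := subY|have [_ [_ sV]] := subX]; exact: sV.
exact: nf_cons gb nfv.
Qed.

End FreeProduct.

(** * Equational closure and counting *)

Section EquationalClosure.
Variable G : Group.
Local Notation system := (seq (seq (option G * bool))).

(** One solution is fixed per system, so that an element of the closure is determined by how it is
    computed. Unsolvable systems get the value 1. *)
Definition solution (es : system) : G :=
  if pselect (exists t, forall e, List.In e es -> solves t e) is left ex
  then projT1 (cid ex) else gone.

Inductive closure (S : gset G) : gset G :=
| closure_in a : S a -> closure S a
| closure_solution es :
    (forall e c b, List.In e es -> List.In (Some c, b) e -> closure S c) ->
    closure S (solution es).

Lemma closure_eq_closed S : eq_closed (closure S).
Proof.
move=> es esS [t tes]; exists (solution es).
  by apply: closure_solution => e c b /esS; apply.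
rewrite /solution; case: pselect => [ex|[]]; last by exists t.
by case: (cid ex).
Qed.

(* Straight-line programs: an instruction pushes an element of [X], one of the
   finitely many elements of [Y], or the solution of a system whose
   coefficients are given by their positions in the stack. *)
Variables (Y : seq G) (X : gset G).
Local Notation instr := (nat + {x : G | X x})%type.
Local Notation shape := (seq (seq (option nat * bool))).

Definition instantiate (st : seq G) (sh : shape) : system :=
  [seq [seq (omap (nth gone st) l.1, l.2) | l <- e] | e <- sh].

(** The instructions that push no element of [X] are coded by natural numbers; a number coding
    nothing leaves the stack unchanged. *)
Definition step (st : seq G) (i : instr) : seq G :=
  match i with
  | inr x => sval x :: st
  | inl n => match (unpickle n : option (nat + shape)) with
             | Some (inl j) => nth gone Y j :: st
             | Some (inr sh) => solution (instantiate st sh) :: st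
             | None => st
             end
  end.

Definition run (p : seq instr) (st : seq G) := foldl step st p.

Lemma run_cat p q st : run (p ++ q) st = run q (run p st).
Proof. exact: foldl_cat. Qed.

Lemma run_keeps p st a : List.In a st -> List.In a (run p st).
Proof.
elim: p st => //= i p IH st ast; apply: IH.
case: i => [n|x] /=; last by right.
by case: (unpickle n) => [[j|sh]|] //; right.
Qed.

Lemma In_nth (st : seq G) a : List.In a st -> exists i, nth gone st i = a.
Proof.
by elim: st => //= b st IH [->|/IH[i <-]]; [exists 0|exists i.+1].
Qed.

Lemma runs_all (cs : seq G) st :
  (forall c, List.In c cs -> forall st, exists p, List.In c (run p st)) ->
  exists p, forall c, List.In c cs -> List.In c (run p st).
Proof.
elim: cs st => [|c cs IH] st H; first by exists [::].
have [|p pcs] := IH st; first by move=> d dcs; apply: H; right.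
have [q qc] := H c (or_introl erefl) (run p st).
exists (p ++ q) => d /= [<-|/pcs dp]; rewrite run_cat //.
exact: run_keeps.
Qed.

Definition coefs (es : system) : seq G :=
  pmap (fun l => l.1) (flatten es).

Lemma coefsP es c : List.In c (coefs es) <->
  exists e b, List.In e es /\ List.In (Some c, b) e.
Proof.
rewrite /coefs; elim: es => [|e es IH] /=; first by split=> // -[e [b []]].
rewrite pmap_cat List.in_app_iff IH; split.
  move=> [|[e' [b [h1 h2]]]]; last by exists e', b; split; [right|].
  move=> ce; suff [b cb] : exists b, List.In (Some c, b) e.
    by exists e, b; split=> //; left.
  elim: e ce {IH} => //= -[[d|] b] e IHe /=.
    by move=> [->|/IHe[b' h]]; [exists b; left|exists b'; right].
  by move=> /IHe[b' h]; exists b'; right.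
move=> [e' [b [[->|h1] h2]]]; last by right; exists e', b.
left; elim: e' h2 {IH} => //= -[[d|] b'] e' IHe /= [].
- by move=> [-> _]; left.
- by move=> /IHe; right.
- by [].
- by move=> /IHe.
Qed.

(** The initial stack is arbitrary, so that programs for the coefficients of a system can run one
    after another; no entry is ever removed, so all coefficients are available at the end. *)
Lemma closure_run a : closure (fun a => List.In a Y \/ X a) a ->
  forall st, exists p st', run p st = a :: st'.
Proof.
elim=> {a} [a [aY|aX] st|es _ IH st].
- have [j ja] := In_nth aY.
  exists [:: inl (pickle (inl j : nat + shape))], st.
  by rewrite /= pickleK ja.
- by exists [:: inr (exist _ a aX)], st.
have [|p pes] := @runs_all (coefs es) st.
  move=> c /coefsP[e [b [ees ce]]] st'; have [p [st'' E]] := IH e c b ees ce st'.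
  by exists p; rewrite E; left.
set st1 := run p st in pes.
suff [sh shE] : exists sh, instantiate st1 sh = es.
  exists (rcons p (inl (pickle (inr sh : nat + shape)))), st1.
  by rewrite -cats1 run_cat /= pickleK -/st1 shE.
have : forall e c b, List.In e es -> List.In (Some c, b) e -> List.In c st1.
  by move=> e c b ees ce; apply: pes; apply/coefsP; exists e, b.
elim: es {IH pes} => [|e es IHes] H; first by exists [::].
have [|sh <-] := IHes; first by move=> e' c b h1; apply: H; right.
suff [sh1 sh1E] : exists s, [seq (omap (nth gone st1) l.1, l.2) | l <- s] = e.
  by exists (sh1 :: sh); rewrite /instantiate /= sh1E.
have {}H c b : List.In (Some c, b) e -> List.In c st1 by apply: H; left.
elim: e H => [|[[c|] b] e IHe] H; first by exists [::].
- have [|s <-] := IHe; first by move=> c' b' h; apply: (H c' b'); right.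
  have [i ic] := In_nth (H c b (or_introl erefl)).
  by exists ((Some i, b) :: s); rewrite /= ic.
- have [|s <-] := IHe; first by move=> c' b' h; apply: (H c' b'); right.
  by exists ((None, b) :: s).
Qed.

(** A uniquely decodable code: the first letter, [x0] or [x1], tells the two kinds of instruction
    apart, and [n.+1] makes even n = 0 start with [x0]. *)
Definition instr_code (x0 x1 : {x : G | X x}) (i : instr) : seq {x : G | X x} :=
  match i with
  | inl n => rcons (nseq n.+1 x0) x1
  | inr x => [:: x1; x]
  end.

Lemma instr_code_inj x0 x1 p q : x0 <> x1 ->
  flatten [seq instr_code x0 x1 i | i <- p] =
  flatten [seq instr_code x0 x1 i | i <- q] -> p = q.
Proof.
move=> x01; elim: p q => [|i p IH] [|j q] //=.
- by case: j.
- by case: i.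
case: i j => [n|x] [m|y] //=; rewrite ?cat_rcons.
- have nseq_inj (k k' : nat) u v : nseq k x0 ++ x1 :: u = nseq k' x0 ++ x1 :: v ->
      k = k' /\ u = v.
    elim: k k' => [|k IHk] [|k'] //=.
    + by move=> [->].
    + by move=> [/esym/x01].
    + by move=> [/x01].
    + by move=> /(congr1 behead)/IHk[-> ->].
  by move=> /(congr1 behead)/nseq_inj[-> /IH ->].
- by move=> [/x01].
- by move=> [/esym/x01].
- by move=> [-> /IH ->].
Qed.

End EquationalClosure.

(** * Maximal free sets and the free complement *)

Section LocallyFree.
Variable G : Group.
Hypotheses (lfG : locally_free G) (ucG : uncountable_group G).

(** Zorn's lemma is applied to the part [X] added to [Y]: a word has finitely many letters, so it
    lies over [Y] and a single member of the chain, or over [Y] alone. *)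
Lemma maximal_free_set (Y : gset G) : free_set Y ->
  exists S : gset G, [/\ forall a, Y a -> S a, free_set S &
    forall h, ~ S h -> ~ free_set (fun a => S a \/ a = h)].
Proof.
move=> fY; pose Q (X : set G) := free_set (fun a => Y a \/ X a).
have [F FQ totF|X [QX maxX]] := @Zorn_bigcup G Q.
  move=> w wS; have [X FX wX] : exists2 X, F X \/ X = set0 &
      word_over G (fun a => Y a \/ X a) w.
    elim: w wS => [|l w IH]; first by exists set0; [right|exact: List.Forall_nil].
    move=> /List.Forall_cons_iff[lS /IH[X FX wX]].
    have wid (X1 X2 : set G) v : (X1 `<=` X2)%classic ->
        word_over G (fun a => Y a \/ X1 a) v -> word_over G (fun a => Y a \/ X2 a) v.
      by move=> X12; apply: List.Forall_impl => l' [|/X12]; [left|right].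
    case: lS => [Yl|[X' FX' Xl]].
      by exists X => //; apply/List.Forall_cons_iff; split=> //; left.
    have [XX'|X'X] : (X `<=` X')%classic \/ (X' `<=` X)%classic.
      by case: FX => [FX|->]; [exact: totF|left].
    - exists X'; first by left.
      by apply/List.Forall_cons_iff; split; [right|apply: wid wX].
    - by exists X => //; apply/List.Forall_cons_iff; split=> //; right; apply: X'X.
  case: FX wX => [/FQ|->]; first exact.
  move=> wY; apply: fY; apply: List.Forall_impl wY => l [//|[]].
exists (fun a => Y a \/ X a); split=> // [a|h nh fh]; first by left.
apply: (maxX (fun a => X a \/ a = h)).
  split=> [a Xa|XX]; first by left.
  by apply: nh; right; apply: XX; right.
move=> w wS; apply: fh; apply: List.Forall_impl wS => l [?|[?|?]];
  by [left; left|left; right|right].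
Qed.

Lemma closure_maximal (S : gset G) : free_set S ->
  (forall h, ~ S h -> ~ free_set (fun a => S a \/ a = h)) ->
  forall g, closure S g.
Proof.
move=> fS maxS g; apply: contrapT => ng.
have [h nSh fSh] := free_set_extend lfG (@closure_eq_closed G S) (@closure_in G S) fS ng.
exact: maxS nSh fSh.
Qed.

Lemma same_card_inj (H : gset G) (f : G -> {x : G | H x}) :
  injective f -> same_card_as_G H.
Proof.
move=> f_inj.
have le (T U : Type) (k : T -> U) : injective k -> ([set: T] #<= [set: U])%card.
  move=> k_inj; suff [k'] : $|{injfun [set: T] >-> [set: U]}| by exact: inj_card_le k'.
  by apply/injfunPex; exists k => // x y _ _; exact: k_inj.
have sval_inj : injective (sval : {x : G | H x} -> G).
  by move=> [x Hx] [y Hy] /= xy; exact: eq_exist.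
have /card_bijP[k [k' kK k'K]] := Cantor_Bernstein (le _ _ _ sval_inj) (le _ _ _ f_inj).
exists (fun u => val (k (SigSub (mem_set (I : [set: {x : G | H x}]%classic u))))).
split=> [u v /val_inj/(can_inj kK)/(congr1 val)//|g].
exists (val (k' (SigSub (mem_set (I : [set: G]%classic g))))).
set z := k' _; rewrite (_ : SigSub _ = z); last exact: val_inj.
by rewrite /z k'K.
Qed.

Theorem free_complement (A : gset G) : finitely_generated A ->
  exists X : gset G, [/\ free_set X, same_card_as_G (generated X) &
    is_free_product A (generated X)].
Proof.
move=> fgA; have [subA [s As]] := fgA.
have [m [y [fy ys sy]]] := locally_free_fam s lfG.
pose Y := [seq y i | i <- enum 'I_m].
have y_inj : injective y.
  move=> i j yij; apply: contrapT => ij.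
  have : [:: (i, true); (j, false)] = [::] :> seq ('I_m * bool); last by [].
  apply: fy; first by rewrite /redd /= /nocancel /= !andbT; apply/eqP.
  by rewrite /= /lval /= yij gmul_1r gmul_Vr.
have YP a : List.In a Y <-> exists i, a = y i.
  split=> [/(@In_mem G Y a)/mapP[i _ ->]|[i ->]]; first by exists i.
  by apply/(@In_mem G Y); apply: map_f; rewrite mem_enum.
have AY : A = generated (fun a => List.In a Y).
  apply: funext => a; apply/propext; rewrite As; split.
    move=> ga; have /sy[w ->] : generated (sset s) a.
      by apply: generated_min ga => [|b /In_mem bs];
        [exact: generated_subgroup|exact: generated_gen].
    apply: subgroup_ev => [|i]; first exact: generated_subgroup.
    by apply/generated_gen/YP; exists i.
  have -> : (fun x => List.In x s) = sset s.
    by apply: funext => b; apply/propext; exact: In_mem.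
  apply: generated_min => [|b /YP[i ->] //]; exact: generated_subgroup.
have fY : free_set (fun a => List.In a Y).
  move=> w wY; have [w' ->] := word_over_fam (fun c => iffLR (YP c)) wY.
  move=> /reducedE rw w0 w1; case: w0.
  suff -> : w' = [::] by [].
  apply: fy; first by rewrite -(redd_map (Y := {classic G}) _ y_inj).
  by rewrite -w1 word_evalE ev_map.
have [S [YS fS maxS]] := maximal_free_set fY.
pose X : gset G := fun a => S a /\ ~ List.In a Y.
have SE : S = (fun a => List.In a Y \/ X a).
  apply: funext => a; apply/propext; split=> [Sa|[/YS|[]] //].
  by have [|] := pselect (List.In a Y); [left|right].
have fX : free_set X.
  by move=> w wX; apply: fS; apply: List.Forall_impl wX => l [].
(* A program leaving [g] on top of the stack determines [g], so [prog] is injective. *)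
have /choice[prog progE] : forall g, exists p, ohead (run Y (X := X) p [::]) = Some g.
  move=> g; have := closure_maximal fS maxS g; rewrite SE => /closure_run /(_ [::]).
  by move=> [p [st E]]; exists p; rewrite E.
have prog_inj : injective prog by move=> g h e; have := progE g; rewrite e progE => -[].
exists X; split=> //; last first.
  rewrite AY; apply: free_set_free_product; last by rewrite -SE.
  by move=> a aY [].
(* With at most one element in [X], forgetting which one is pushed loses nothing, and programs would
   embed [G] into the natural numbers. *)
have [[x0 [x1 x01]]|noX] := pselect (exists x0 x1 : {x : G | X x}, x0 <> x1); last first.
  case: ucG; exists (fun g => pickle [seq if i is inl n then Some n else None | i <- prog g]).
  move=> g h /(pcan_inj pickleK_inv) e; apply: prog_inj.
  elim: (prog g) (prog h) e => [|i p IH] [|j q] //= [ij /IH ->]; congr (_ :: _).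
  case: i j ij => [n|x] [m'|x'] //= => [[->] //|_]; congr inr.
  by apply: contrapT => xx'; apply: noX; exists x, x'.
(* All letters are positive, so the word is reduced and is determined by its value in the free group
   on [X]. *)
pose word g := [seq (sval x, true) | x <- flatten [seq instr_code x0 x1 i | i <- prog g]].
have wordX g : word_over G X (word g).
  by rewrite /word; elim: (flatten _) => [|[x Xx] v IH];
    [exact: List.Forall_nil|apply/List.Forall_cons_iff].
have wordR g : reduced G (word g).
  by rewrite /word; elim: (flatten _) => // x [|x' v] // IH; split=> // -[_ /=].
have wordH g : generated X (ev G id (word g)).
  by exists (word g); split; [exact: wordX|rewrite word_evalE].
apply: (@same_card_inj _ (fun g => exist _ _ (wordH g))) => g h /(congr1 sval) /=.
move=> /(free_set_word_inj fX (wordX g) (wordX h) (wordR g) (wordR h)) /inj_map e.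
apply: prog_inj; apply: (instr_code_inj x01); apply: e => -[x Xx] [x' Xx'] [xx'].
exact: eq_exist.
Qed.

End LocallyFree.

Theorem theorem1p1 (G : Group) :
  locally_free G -> uncountable_group G ->
  (forall A : gset G, finitely_generated A ->
     exists H : gset G,
       is_subgroup H /\ same_card_as_G H /\ is_free_product A H) /\
  (exists F : gset G, free_subgroup F /\ same_card_as_G F).
Proof.
move=> lfG ucG; split=> [A /(free_complement lfG ucG)[X [_ cardX AX]]|].
  by exists (generated X); split=> //; exact: generated_subgroup.
(* The free subgroup is a complement of the trivial subgroup, generated by the empty list. *)
have [|X [fX cardX _]] := @free_complement G lfG ucG (generated (fun x => List.In x [::])).
  by split; [exact: generated_subgroup|exists [::]].
exists (generated X); split=> //; split; first exact: generated_subgroup.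
by exists X; split; [exact: generated_gen|].
Qed.
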